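(* Let $\xi^*\in\mathbb{R}^m$ satisfy $\mathcal{Y}(\xi^* )=\mathcal{V}(\xi^* )=\mathcal{P}(\xi^* )=\mathcal{B}(\xi^* )=0$ and $\mathcal{J}(\xi^* )=0$, and assume that the $m\times m$ Jacobian matrix $[\mathcal{P}_\xi(\xi^* ),\mathcal{B}_\xi(\xi^* ),\mathcal{Y}_\xi(\xi^* ),\mathcal{V}_\xi(\xi^* ),\mathcal{J}_\xi(\xi^* )]$ (of the map $(\mathcal{P},\mathcal{B},\mathcal{Y},\mathcal{V},\mathcal{J}):\mathbb{R}^m\to\mathbb{R}^m$) is non-singular. Let $\alpha_i^*=\alpha_i(\xi^* )$ and assume $\alpha_1^*<0$, $\alpha_3^*<0$ and that $\beta=\alpha_3^*/\alpha_1^*$ is not an integer. Then for every integer $M\ge 1$ there is a unique collection of polynomial functions of $s$, $\xi_n(s)\in\mathbb{R}^m$ and $p_n(s),b_n(s),y_n(s),v_n(s),z_n(s),\lambda_n(s)\in\mathbb{R}$, $0\le n\le M-1$, such that the expansions $$\tilde\xi(s,\delta)=\sum_{n=0}^{M-1}\xi_n(s)\delta^n,\quad \tilde p=\sum_{n=0}^{M-1}p_n(s)\delta^n,\quad \tilde b=\sum_{n=0}^{M-1}b_n(s)\delta^n,\quad \tilde y=\sum_{n=0}^{M-1}y_n(s)\delta^n,$$ $$\tilde v=\sum_{n=0}^{M-1}v_n(s)\delta^n,\quad \tilde z=\sum_{n=0}^{M-1}z_n(s)\delta^n,\quad \lambda_N=\sum_{n=0}^{M-1}\lambda_n(s)\delta^n$$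 satisfy, as $\delta\to0$, with $\xi=\xi^*+\delta^2\tilde\xi$ and $'=d/ds$, the equations $$\tilde\xi'=F(\xi)+G(\xi)\lambda_N,\quad \tilde p'=\alpha_1(\xi),\quad \tilde b'=\alpha_2(\xi)-\alpha_3(\xi)\lambda_N,\quad \tilde y'=\tilde v,\quad \tilde v'=\tilde b+\tilde p\lambda_N,\quad \delta\tilde z'=-\tilde z-\lambda_N,\quad \lambda_N=\tilde z-\tilde y$$ up to errors $\mathcal{O}(\delta^M)$ (for each fixed $s$), and the conditions at $s=0$ $$\tilde p(0,\delta)=0,\quad \mathcal{P}(\xi^*+\delta^2\tilde\xi(0,\delta))-\delta^2\tilde p(0,\delta)=0,\quad \mathcal{B}(\xi^*+\delta^2\tilde\xi(0,\delta))-\delta^2\tilde b(0,\delta)=0,$$ $$\mathcal{Y}(\xi^*+\delta^2\tilde\xi(0,\delta))-\delta^6\tilde y(0,\delta)=0,\quad \mathcal{V}(\xi^*+\delta^2\tilde\xi(0,\delta))-\delta^4\tilde v(0,\delta)=0,\quad \mathcal{J}(\xi^*+\delta^2\tilde\xi(0,\delta))=0$$ up to errors $\mathcal{O}(\delta^{M+2})$. Moreover these polynomials satisfy, for even indices $n=2\nu$, $$p_{2\nu},b_{2\nu},\xi_{2\nu}\in P_{\nu+1},\quad y_{2\nu},z_{2\nu}\in P_\nu,\quad v_{2\nu}\in P_{\nu-1},\quad \lambda_{2\nu}\in P_\nu,$$ and for odd indices $n=2\nu+1$, $$p_{2\nu+1},b_{2\nu+1},\xi_{2\nu+1}\in P_{\nu-3},\quad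 y_{2\nu+1},z_{2\nu+1}\in P_{\nu-1},\quad v_{2\nu+1}\in P_{\nu-2},\quad \lambda_{2\nu+1}\in P_{\nu-4}.$$
   Context: Polynomial spaces: for an integer $n\ge0$, $P_n$ is the real vector space of polynomials in $s$ spanned by $\{s^n,s^{n-3},s^{n-6},\dots,s^q\}$, where $q\in\{0,1,2\}$ and $q\equiv n\pmod 3$; for $n<0$, $P_n=\{0\}$. An $\mathbb{R}^m$-valued polynomial is said to lie in $P_n$ if each of its components does. Mechanical system: the state is $\xi\in\mathbb{R}^m$ ($m\ge4$), evolving by $\dot\xi=F(\xi)+G_T(\xi)\lambda_T+G_N(\xi)\lambda_N$ with smooth ($C^\infty$) vector fields $F,G_T,G_N$. For a vector field $H$ and a function $f$, $\mathcal{L}_H f$ denotes the Lie derivative of $f$ along $H$. The tangential and normal contact coordinates are smooth functions $x=\mathcal{X}(\xi)$ and $y=\mathcal{Y}(\xi)$ with $\mathcal{L}_{G_T}\mathcal{X}=\mathcal{L}_{G_N}\mathcal{X}=\mathcal{L}_{G_T}\mathcal{Y}=\mathcal{L}_{G_N}\mathcal{Y}=0$. Put $\mathcal{U}=\mathcal{L}_F\mathcal{X}$, $\mathcal{V}=\mathcal{L}_F\mathcal{Y}$, $\mathcal{B}=\mathcal{L}_F\mathcal{V}$, $A=\mathcal{L}_{G_T}\mathcal{U}$, $B=\mathcal{L}_{G_N}\mathcal{U}=\mathcal{L}_{G_T}\mathcal{V}$, $C=\mathcal{L}_{G_N}\mathcal{V}$, with $A>0$, $C>0$, $AC-B^2>0$.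 With friction coefficient $\mu$, in positive slip $\lambda_T=-\mu\lambda_N$, so $\dot\xi=F(\xi)+G(\xi)\lambda_N$ with $G=G_N-\mu G_T$. Put $\mathcal{P}=\mathcal{L}_G\mathcal{V}=C-\mu B$ (with $\mathcal{L}_G\mathcal{P}=0$), and $\alpha_1=\mathcal{L}_F\mathcal{P}$, $\alpha_2=\mathcal{L}_F\mathcal{B}$, $\alpha_3=-\mathcal{L}_G\mathcal{B}$; all are smooth functions of $\xi$. $\mathcal{J}:\mathbb{R}^m\to\mathbb{R}^{m-4}$ is a smooth function used to select a particular point. The subscript $\xi$ denotes the derivative with respect to $\xi$. In the displayed system, $\tilde\xi,\tilde p,\tilde b,\tilde y,\tilde v,\tilde z,\lambda_N$ are treated as independent unknown functions of $s$ depending on the small parameter $\delta>0$. *)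

(* Defs.v *)
From HB Require Import structures.
From mathcomp Require Import all_boot all_order all_algebra.
From mathcomp Require Import all_classical all_reals all_analysis.
Set Implicit Arguments.
Unset Strict Implicit.
Unset Printing Implicit Defensive.
Import Order.TTheory GRing.Theory Num.Theory.
Import numFieldNormedType.Exports.
Local Open Scope classical_set_scope.
Local Open Scope ring_scope.

Section Smooth.
Variables (R : realType) (m : nat).

(* [Cr r f]: all partial derivatives of [f] of order at most [r] exist on the
   whole space and are continuous. *)
Fixpoint Cr (r : nat) (f : 'rV[R]_m -> R) : Prop :=
  continuous f /\
  match r with
  | 0 => True
  | r'.+1 => forall i : 'I_m,
      (forall x, derivable f x (delta_mx 0 i)) /\
      Cr r' (fun x => 'D_(delta_mx 0 i) f x)
  end.

Definition smooth (f : 'rV[R]_m -> R) : Prop := forall r : nat, Cr r f.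

Definition smooth_map (n : nat) (f : 'rV[R]_m -> 'rV[R]_n) : Prop :=
  forall j : 'I_n, smooth (fun x => f x 0 j).

Definition lieD (H : 'rV[R]_m -> 'rV[R]_m) (f : 'rV[R]_m -> R)
  : 'rV[R]_m -> R := fun x => 'D_(H x) f x.

End Smooth.

Section ContactSystem.
Variables (R : realType) (m : nat).

(* The mechanical system with one frictional point contact: the vector fields of
   xi' = F + GT * lambda_T + GN * lambda_N, the tangential and normal contact
   coordinates, and the friction coefficient. *)
Record contact_system := ContactSystem {
  cF : 'rV[R]_m -> 'rV[R]_m;
  cGT : 'rV[R]_m -> 'rV[R]_m;
  cGN : 'rV[R]_m -> 'rV[R]_m;
  cX : 'rV[R]_m -> R;
  cY : 'rV[R]_m -> R;
  cmu : R }.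

Variable S : contact_system.

Definition calU := lieD (cF S) (cX S).
Definition calV := lieD (cF S) (cY S).
Definition calB := lieD (cF S) calV.
Definition coefA := lieD (cGT S) calU.
Definition coefB := lieD (cGN S) calU.
Definition coefC := lieD (cGN S) calV.

(* The input field in positive slip, where lambda_T = - mu * lambda_N. *)
Definition cG : 'rV[R]_m -> 'rV[R]_m := fun x => cGN S x - cmu S *: cGT S x.

(* Under [contact_assumptions] this is coefC - cmu * coefB. *)
Definition calP := lieD cG calV.

Definition alpha1 := lieD (cF S) calP.
Definition alpha2 := lieD (cF S) calB.
Definition alpha3 : 'rV[R]_m -> R := fun x => - lieD cG calB x.

Record contact_assumptions : Prop := ContactAssumptions {
  smooth_cF : smooth_map (cF S);
  smooth_cGT : smooth_map (cGT S);
  smooth_cGN : smooth_map (cGN S);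
  smooth_cX : smooth (cX S);
  smooth_cY : smooth (cY S);
  lieD_GT_X : forall x, lieD (cGT S) (cX S) x = 0;
  lieD_GN_X : forall x, lieD (cGN S) (cX S) x = 0;
  lieD_GT_Y : forall x, lieD (cGT S) (cY S) x = 0;
  lieD_GN_Y : forall x, lieD (cGN S) (cY S) x = 0;
  coefB_sym : forall x, coefB x = lieD (cGT S) calV x;
  coefA_gt0 : forall x, 0 < coefA x;
  coefC_gt0 : forall x, 0 < coefC x;
  coef_det_gt0 : forall x, 0 < coefA x * coefC x - coefB x ^+ 2;
  lieD_G_P : forall x, lieD cG calP x = 0 }.

End ContactSystem.

(* The map (P, B, Y, V, J) : R^m -> R^m with m = 4 + k. In its library Jacobian,
   which acts on row vectors from the right, the columns are the gradients. *)
Definition constraint_map (R : realType) (k : nat)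
    (S : contact_system R (4 + k)) (J : 'rV[R]_(4 + k) -> 'rV[R]_k)
    (x : 'rV[R]_(4 + k)) : 'rV[R]_(4 + k) :=
  row_mx (\row_(i < 4) [:: calP S x; calB S x; cY S x; calV S x]`_i) (J x).

(* The space P_n, for n of any sign: the span of s^n, s^(n-3), ..., s^q with
   q = n mod 3, and {0} for negative n. *)
Definition in_P (R : realType) (n : int) (f : {poly R}) : Prop :=
  match n with
  | Posz d => exists c : nat -> R,
      f = \sum_(j < (d %/ 3).+1) c j *: 'X^(d - 3 * j)
  | Negz _ => f = 0
  end.

Definition in_P_row (R : realType) (m : nat) (n : int) (f : 'rV[{poly R}]_m)
  : Prop := forall i : 'I_m, in_P n (f 0 i).

Section Expansion.
Variables (R : realType) (m M : nat).

Record coefs := Coefs {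
  xi_ : {ffun 'I_M -> 'rV[{poly R}]_m};
  p_ : {ffun 'I_M -> {poly R}};
  b_ : {ffun 'I_M -> {poly R}};
  y_ : {ffun 'I_M -> {poly R}};
  v_ : {ffun 'I_M -> {poly R}};
  z_ : {ffun 'I_M -> {poly R}};
  lam_ : {ffun 'I_M -> {poly R}} }.

Definition series_at (f : {ffun 'I_M -> {poly R}}) (s delta : R) : R :=
  \sum_(n < M) (f n).[s] * delta ^+ n.

Definition row_series_at (f : {ffun 'I_M -> 'rV[{poly R}]_m}) (s delta : R)
  : 'rV[R]_m :=
  \sum_(n < M) delta ^+ n *: map_mx (fun q : {poly R} => q.[s]) (f n).

End Expansion.

(* [f] and [g] agree up to an error O(delta^N) as delta tends to 0, delta > 0. *)
Definition eq_upto (R : realType) (V : normedModType R) (N : nat) (f g : R -> V)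
  : Prop :=
  (fun delta => f delta - g delta) =O_ (0^'+) (fun delta => delta ^+ N : R).

Section FormalSolution.
Variables (R : realType) (k M : nat).
Variables (S : contact_system R (4 + k)) (J : 'rV[R]_(4 + k) -> 'rV[R]_k).
Variables (xis : 'rV[R]_(4 + k)) (c : coefs R (4 + k) M).

Let xit := row_series_at (xi_ c).
Let pt := series_at (p_ c).
Let bt := series_at (b_ c).
Let yt := series_at (y_ c).
Let vt := series_at (v_ c).
Let zt := series_at (z_ c).
Let lamN := series_at (lam_ c).

Let xi (s delta : R) : 'rV[R]_(4 + k) := xis + delta ^+ 2 *: xit s delta.

Record solves_equations : Prop := SolvesEquations {
  eqn_xi : forall s, eq_upto M
    (fun delta => derive1 (fun t => xit t delta) s)
    (fun delta => cF S (xi s delta) + lamN s delta *: cG S (xi s delta));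
  eqn_p : forall s, eq_upto M
    (fun delta => derive1 (fun t => pt t delta) s)
    (fun delta => alpha1 S (xi s delta));
  eqn_b : forall s, eq_upto M
    (fun delta => derive1 (fun t => bt t delta) s)
    (fun delta =>
       alpha2 S (xi s delta) - alpha3 S (xi s delta) * lamN s delta);
  eqn_y : forall s, eq_upto M
    (fun delta => derive1 (fun t => yt t delta) s)
    (fun delta => vt s delta);
  eqn_v : forall s, eq_upto M
    (fun delta => derive1 (fun t => vt t delta) s)
    (fun delta => bt s delta + pt s delta * lamN s delta);
  eqn_z : forall s, eq_upto M
    (fun delta => delta * derive1 (fun t => zt t delta) s)
    (fun delta => - zt s delta - lamN s delta);
  eqn_lam : forall s, eq_upto M
    (fun delta => lamN s delta)
    (fun delta => zt s delta - yt s delta) }.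

Record solves_conditions : Prop := SolvesConditions {
  cond_p : eq_upto (M + 2) (fun delta => pt 0 delta) (fun=> 0);
  cond_P : eq_upto (M + 2)
    (fun delta => calP S (xi 0 delta) - delta ^+ 2 * pt 0 delta) (fun=> 0);
  cond_B : eq_upto (M + 2)
    (fun delta => calB S (xi 0 delta) - delta ^+ 2 * bt 0 delta) (fun=> 0);
  cond_Y : eq_upto (M + 2)
    (fun delta => cY S (xi 0 delta) - delta ^+ 6 * yt 0 delta) (fun=> 0);
  cond_V : eq_upto (M + 2)
    (fun delta => calV S (xi 0 delta) - delta ^+ 4 * vt 0 delta) (fun=> 0);
  cond_J : eq_upto (M + 2) (fun delta => J (xi 0 delta)) (fun=> 0) }.

Definition formal_solution : Prop := solves_equations /\ solves_conditions.

End FormalSolution.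

Section DegreePattern.
Variables (R : realType) (m M : nat) (c : coefs R m M).

Definition even_pattern : Prop := forall (n : 'I_M) (nu : nat),
  n = (2 * nu)%N :> nat ->
  [/\ in_P (nu%:Z + 1) (p_ c n) /\ in_P (nu%:Z + 1) (b_ c n),
      in_P_row (nu%:Z + 1) (xi_ c n),
      in_P nu%:Z (y_ c n) /\ in_P nu%:Z (z_ c n),
      in_P (nu%:Z - 1) (v_ c n)
    & in_P nu%:Z (lam_ c n)].

Definition odd_pattern : Prop := forall (n : 'I_M) (nu : nat),
  n = (2 * nu + 1)%N :> nat ->
  [/\ in_P (nu%:Z - 3) (p_ c n) /\ in_P (nu%:Z - 3) (b_ c n),
      in_P_row (nu%:Z - 3) (xi_ c n),
      in_P (nu%:Z - 1) (y_ c n) /\ in_P (nu%:Z - 1) (z_ c n),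
      in_P (nu%:Z - 2) (v_ c n)
    & in_P (nu%:Z - 4) (lam_ c n)].

End DegreePattern.

(* Main.v *)
(** Expanding the equations in powers of [delta], the unknowns of order [n]
    enter the equations of order [n] affinely, with coefficients frozen at [xi*].
    The equation for [p_n] is an integration with [p_n(0) = 0]; in particular
    [p_0 = alpha_1 s]. Eliminating [z_n], [y_n], [v_n], [b_n] leaves, for
    [l = lambda_n], an equation [2 l''' + (alpha_1 - alpha_3) l + alpha_1 s l' = r]
    with a polynomial [r]. The operator on the left is triangular in the monomials
    [s^d], with diagonal entries [alpha_1 (d + 1) - alpha_3], nonzero because [beta]
    is not an integer: it is bijective on polynomials, so that requiring [y_n],
    [v_n], [b_n] to be polynomials replaces their initial conditions. Finally
    [xi_n] is an integral whose constant is fixed by the non-singular Jacobian.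

    Smooth functions of [xi* + delta^2 xi] are replaced by their Taylor polynomials
    at [xi*], evaluated in [R[s][delta]]. For the degree pattern, the coefficients
    of [delta^n] in [delta^2 xi] and in [lambda_N] lie in [P_(n/2)] for even [n]
    and in [P_((n-1)/2 - 4)] for odd [n]; this property is stable under products
    because [P_n] is contained in [P_(n+3)] and the product of two odd terms lands
    9 = 3 * 3 below the bound for its order. *)
From HB Require Import structures.
Require Import Defs.
From mathcomp Require Import all_boot all_order all_algebra.
From mathcomp Require Import all_classical all_reals all_analysis.
From mathcomp Require Import ring lra zify.
Set Implicit Arguments.
Unset Strict Implicit.
Unset Printing Implicit Defensive.
Import Order.TTheory GRing.Theory Num.Theory.
Import numFieldNormedType.Exports.
Local Open Scope ring_scope.

(** * Polynomial spaces *)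

Section GradedSpaces.
Variable R : numFieldType.
Implicit Types (f g : {poly R}) (n : int).

(* The space P_n, read on coefficients; see [in_P_of_inP]. *)
Definition inP n f := forall i, f`_i != 0 -> exists t : nat, n = (i + 3 * t)%N.

Lemma inP0 n : inP n 0.
Proof. by move=> i; rewrite coef0 eqxx. Qed.

Lemma inPC (c : R) : inP 0 c%:P.
Proof.
move=> i; rewrite coefC; have [->|_] := eqVneq i 0%N; last by rewrite eqxx.
by exists 0%N.
Qed.

Lemma inPX : inP 1 'X.
Proof.
move=> i; rewrite coefX; have [->|_] := eqVneq i 1%N; last by rewrite eqxx.
by exists 0%N.
Qed.

Lemma inPD n f g : inP n f -> inP n g -> inP n (f + g).
Proof.
move=> hf hg i; rewrite coefD; case: (eqVneq f`_i 0) => [->|/hf //].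
by rewrite add0r => /hg.
Qed.

Lemma inPZ n c f : inP n f -> inP n (c *: f).
Proof.
by move=> hf i; rewrite coefZ mulf_eq0 negb_or => /andP[_ /hf].
Qed.

Lemma inPN n f : inP n f -> inP n (- f).
Proof. by move=> hf i; rewrite coefN oppr_eq0 => /hf. Qed.

Lemma inPB n f g : inP n f -> inP n g -> inP n (f - g).
Proof. by move=> hf hg; apply/inPD/inPN. Qed.

Lemma inP_sum n (I : Type) (r : seq I) (Q : pred I) (F : I -> {poly R}) :
  (forall i, Q i -> inP n (F i)) -> inP n (\sum_(i <- r | Q i) F i).
Proof.
by move=> h; apply: (big_ind (inP n)) => //; [exact: inP0 | exact: inPD].
Qed.

Lemma inPM n1 n2 f g : inP n1 f -> inP n2 g -> inP (n1 + n2) (f * g).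
Proof.
move=> hf hg i; rewrite coefM => h.
have [j hj] : exists j : 'I_i.+1, f`_j * g`_(i - j) != 0.
  apply/existsP; apply: contraNT h; rewrite negb_exists => /forallP h.
  by rewrite big1 // => j _; apply/eqP; rewrite -[_ == _]negbK.
move: hj; rewrite mulf_eq0 negb_or => /andP[/hf[t ->] /hg[t' ->]].
by exists (t + t')%N; have := ltn_ord j; lia.
Qed.

Lemma inP_shift n (t : nat) f : inP n f -> inP (n + (3 * t)%N) f.
Proof. by move=> hf i /hf[t' ->]; exists (t' + t)%N; lia. Qed.

Lemma inP_deriv n f : inP n f -> inP (n - 1) f^`().
Proof.
move=> hf i; rewrite coef_deriv mulrn_eq0 negb_or /= => /hf[t ->].
by exists t; lia.
Qed.

Lemma inP_coef0 n f : inP n f -> inP n (f`_0)%:P.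
Proof.
move=> hf i; rewrite coefC; have [->|_] := eqVneq i 0%N; last by rewrite eqxx.
exact: hf.
Qed.

(* The constant coefficient is 0, thanks to the convention x / 0 = 0. *)
Definition integ f := \poly_(i < (size f).+1) (f`_i.-1 / i%:R).

Lemma coef_integ f i : (integ f)`_i = f`_i.-1 / i%:R.
Proof.
rewrite coef_poly; case: ltnP => // h; rewrite nth_default ?mul0r //.
by rewrite -ltnS; case: i h.
Qed.

Lemma integ0 f : (integ f).[0] = 0.
Proof. by rewrite horner_coef0 coef_integ invr0 mulr0. Qed.

Lemma deriv_integ f : (integ f)^`() = f.
Proof.
apply/polyP => i; rewrite coef_deriv coef_integ /= -[_ *+ _]mulr_natr.
by rewrite divfK // pnatr_eq0.
Qed.

Lemma deriv_inj f g : f^`() = g^`() -> f.[0] = g.[0] -> f = g.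
Proof.
move=> hd; rewrite !horner_coef0 => h0; apply/polyP => -[//|i].
move/polyP: hd => /(_ i); rewrite !coef_deriv => /eqP.
by rewrite eqrMn2r //= => /eqP.
Qed.

(* What is left of the equations of order n after elimination of all unknowns but
   lambda_n; see [slip_elim]. *)
Definition slip_op (a1 a3 : R) f :=
  2%:R *: f^`(3) + (a1 - a3) *: f + a1 *: ('X * f^`()).

(** The third derivative lowers the degree by 3, which stays within the same residue class and
    inside P_n; multiplying the derivative by s restores the degree. *)
Lemma inP_slip_op a1 a3 n f : inP n f -> inP n (slip_op a1 a3 f).
Proof.
move=> hf; apply: inPD; first apply: inPD; apply: inPZ => //.
  have := inP_shift 1 (inP_deriv (inP_deriv (inP_deriv hf))).
  by rewrite -addrA -addrA -addrA addrA; congr inP; lia.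
by have := inPM inPX (inP_deriv hf); congr inP; lia.
Qed.

(** Makes the triangular shape visible: degree i receives only degrees i and i + 3, with diagonal
    entry a1 (i + 1) - a3. *)
Lemma coef_slip_op a1 a3 f i : (slip_op a1 a3 f)`_i =
  2%:R * (f`_(i + 3) *+ (i + 3) ^_ 3) + (a1 * i.+1%:R - a3) * f`_i.
Proof.
rewrite /slip_op !coefD !coefZ coef_derivn coefXM addnC -addrA.
congr (_ + _); case: i => [|i]; first by rewrite mulr0 addr0 /= mulr1.
rewrite coef_deriv /= -[_ *+ i.+1]mulr_natr -[in RHS]natr1; ring.
Qed.

Section Bijective.
Variables a1 a3 : R.
Hypothesis ha : forall d : nat, a1 * d.+1%:R != a3.

Lemma slip_opB f g : slip_op a1 a3 (f - g) = slip_op a1 a3 f - slip_op a1 a3 g.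
Proof.
apply/polyP => i; rewrite [RHS]coefB !coef_slip_op !coefB mulrnBl; ring.
Qed.

Lemma slip_opD f g : slip_op a1 a3 (f + g) = slip_op a1 a3 f + slip_op a1 a3 g.
Proof.
apply/polyP => i; rewrite [RHS]coefD !coef_slip_op !coefD mulrnDl; ring.
Qed.

(** A nonzero polynomial in the kernel would have its leading coefficient killed by a diagonal
    entry, and these are nonzero. *)
Lemma slip_op_inj f g : slip_op a1 a3 f = slip_op a1 a3 g -> f = g.
Proof.
move=> h; apply/eqP; rewrite -subr_eq0; apply: contraT => nz.
have /polyP/(_ (size (f - g)).-1) : slip_op a1 a3 (f - g) = 0.
  by rewrite slip_opB h subrr.
rewrite coef_slip_op coef0.
have -> : (f - g)`_((size (f - g)).-1 + 3) = 0.
  rewrite nth_default // (leq_trans (leqSpred _)) //.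
  by rewrite -[in leqLHS]addn1 leq_add2l.
rewrite mul0rn mulr0 add0r => /eqP; rewrite mulf_eq0 subr_eq0 (negPf (ha _)) /=.
by rewrite -lead_coefE lead_coef_eq0 (negPf nz).
Qed.

(** Back substitution from the top degree. A monomial is added only where the right-hand side has a
    nonzero coefficient, so one solution g respects every P_n that contains f. *)
Lemma slip_op_surj f : exists2 g, slip_op a1 a3 g = f
  & forall n, inP n f -> inP n g.
Proof.
have [N] : exists N, (size f <= N)%N by exists (size f).
elim: N f => [|N IH] f hs.
  exists 0 => [|n _]; last exact: inP0.
  move: hs; rewrite size_poly_leq0 => /eqP ->.
  by apply/polyP => i; rewrite coef_slip_op !coef0 mul0rn !mulr0 addr0.
(* This monomial reproduces the coefficient of degree N; what remains has size at most N. *)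
pose h := (f`_N / (a1 * N.+1%:R - a3)) *: 'X^N.
have hP n : inP n f -> inP n h.
  move=> hf i; rewrite coefZ coefXn.
  have [->|_] := eqVneq i N; rewrite ?mulr0 ?eqxx // mulr1 mulf_eq0 negb_or.
  by move=> /andP[/hf].
have [|g hg gP] := IH (f - slip_op a1 a3 h).
  apply/leq_sizeP => j hj; rewrite coefB coef_slip_op !coefZ !coefXn.
  rewrite [(j + 3)%N == N]gtn_eqF; last by lia.
  rewrite mulr0 mul0rn mulr0 add0r.
  have [->|jN] := eqVneq j N.
    by rewrite mulr1 mulrC divfK ?subrr // subr_eq0.
  by rewrite !mulr0 subr0 nth_default //; apply: leq_trans hs _; lia.
exists (g + h) => [|n hf].
  by rewrite slip_opD hg subrK.
apply: inPD (hP _ hf); apply: gP; apply: inPB => //.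
exact/inP_slip_op/hP.
Qed.
End Bijective.
End GradedSpaces.

(** * Gradings of polynomials in delta with coefficients in R[s] *)

Section Weights.
Variable R : numFieldType.
Implicit Types X Y : {poly {poly R}}.

(* The coefficient of delta^n of a smooth function of xi lies in P_(weight n). *)
Definition weight (n : nat) : int := if odd n then n./2%:Z - 4 else n./2%:Z.

Lemma weightD i j : exists t : nat, weight (i + j) = weight i + weight j + (3 * t)%N.
Proof.
have hi := odd_double_half i; have hj := odd_double_half j.
have hij := odd_double_half (i + j).
rewrite /weight; rewrite oddD in hij *.
case: (odd i) (odd j) hi hj hij => [] [] /= hi hj hij.
- by exists 3%N; lia.
- by exists 0%N; lia.
- by exists 0%N; lia.
- by exists 0%N; lia.
Qed.

Lemma weightS2 n : weight n.+2 = weight n + 1.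
Proof. by rewrite /weight /= negbK; case: odd; lia. Qed.

(** The offset [a] separates the two kinds of series: 0 for delta^2 xi, lambda_N and smooth
    functions of xi, and 1 for p. Only the first k coefficients are constrained. *)
Definition graded (a : int) k X :=
  forall j, (j < k)%N -> inP (weight j + a) X`_j.

Lemma gradedC k c : graded 0 k c%:P%:P.
Proof.
move=> j _; rewrite coefC; have [->|_] := eqVneq j 0%N; last exact: inP0.
exact: inPC.
Qed.

Lemma gradedD a k X Y : graded a k X -> graded a k Y -> graded a k (X + Y).
Proof. by move=> hX hY j hj; rewrite coefD; apply: inPD; auto. Qed.

Lemma gradedB a k X Y : graded a k X -> graded a k Y -> graded a k (X - Y).
Proof. by move=> hX hY j hj; rewrite coefB; apply: inPB; auto. Qed.

Lemma graded_sum a k (I : Type) (r : seq I) (F : I -> {poly {poly R}}) :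
  (forall i, graded a k (F i)) -> graded a k (\sum_(i <- r) F i).
Proof. by move=> h j hj; rewrite coef_sum; apply: inP_sum => i _; apply: h. Qed.

Lemma gradedM a b k X Y :
  graded a k X -> graded b k Y -> graded (a + b) k (X * Y).
Proof.
move=> hX hY j hj; rewrite coefM; apply: inP_sum => -[i /= hi] _.
have [t ht] := weightD i (j - i); rewrite subnKC // in ht.
rewrite ht addrAC; apply: inP_shift; rewrite addrACA.
by apply: inPM; [apply: hX | apply: hY]; lia.
Qed.

End Weights.

(* The functions are abstracted to a type [T] with a value at the base point and
   partial derivatives, and the arguments live in any commutative ring [B], so that
   the same Taylor polynomial can be evaluated in R and in R[s][delta]. *)
Section TaylorPolynomials.
Variables (R : numFieldType) (m : nat) (T : Type).
Variables (v : T -> R) (D : 'I_m -> T -> T).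

Section Eval.
Variables (B : comNzRingType) (iota : R -> B).

(* The j-th derivative along X, without the factor 1 / j!. *)
Fixpoint taylor_term (X : 'I_m -> B) (j : nat) (f : T) : B :=
  if j is j'.+1 then \sum_i X i * taylor_term X j' (D i f) else iota (v f).

Definition taylor_poly (N : nat) (X : 'I_m -> B) (f : T) : B :=
  \sum_(j < N) iota (j`!%:R)^-1 * taylor_term X j f.

End Eval.

Lemma eq_taylor_term (B : comNzRingType) (iota : R -> B) X Y j f :
  X =1 Y -> taylor_term iota X j f = taylor_term iota Y j f.
Proof.
by move=> h; elim: j f => //= j IH f; apply: eq_bigr => i _; rewrite h IH.
Qed.

Lemma eq_taylor_poly (B : comNzRingType) (iota : R -> B) N X Y f :
  X =1 Y -> taylor_poly iota N X f = taylor_poly iota N Y f.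
Proof. by move=> h; apply: eq_bigr => j _; rewrite (eq_taylor_term _ _ _ h). Qed.

Lemma taylor_term_morph (B B' : comNzRingType) (iota : R -> B) (phi : {rmorphism B -> B'})
    X j f : phi (taylor_term iota X j f) = taylor_term (phi \o iota) (phi \o X) j f.
Proof.
elim: j f => //= j IH f; rewrite rmorph_sum; apply: eq_bigr => i _.
by rewrite rmorphM IH.
Qed.

Lemma taylor_poly_morph (B B' : comNzRingType) (iota : R -> B) (phi : {rmorphism B -> B'})
    N X f : phi (taylor_poly iota N X f) = taylor_poly (phi \o iota) N (phi \o X) f.
Proof.
rewrite rmorph_sum; apply: eq_bigr => j _.
by rewrite rmorphM /= taylor_term_morph.
Qed.

Definition cst2 (c : R) : {poly {poly R}} := c%:P%:P.

Notation termA := (taylor_term cst2).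
Notation taylorA := (taylor_poly cst2).
Implicit Types X Y r : 'I_m -> {poly {poly R}}.

Lemma graded_taylor k N X f : (forall i, graded 0 k (X i)) ->
  graded 0 k (taylorA N X f).
Proof.
move=> hX; apply: graded_sum => j.
apply: (gradedM (a := 0) (b := 0)); first exact: gradedC.
move: {N j}(nat_of_ord j) f; elim=> [|j IH] f /=; first exact: gradedC.
by apply: graded_sum => i; apply: (gradedM (a := 0) (b := 0)).
Qed.

Lemma taylor_term_coef0 X j f : (forall i, (X i)`_0 = 0) ->
  (termA X j f)`_0 = if j == 0%N then (v f)%:P else 0.
Proof.
move=> hX; case: j => [|j] /=; first by rewrite coefC.
by rewrite coef_sum big1 // => i _; rewrite coef0M hX mul0r.
Qed.

Lemma taylor_poly_coef0 N X f : (forall i, (X i)`_0 = 0) ->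
  (taylorA N.+1 X f)`_0 = (v f)%:P.
Proof.
move=> hX; rewrite /taylor_poly big_ord_recl coefD coef_sum big1 => [|i _].
  by rewrite addr0 coef0M taylor_term_coef0 //= fact0 invr1 coefC /= mul1r.
by rewrite coef0M taylor_term_coef0 // mulr0.
Qed.

Lemma taylor_term_perturb k X Y r j f :
  (forall i, (X i)`_0 = 0) -> (forall i, (Y i)`_0 = 0) ->
  (forall i, Y i = X i + 'X^k * r i) ->
  exists2 q, termA Y j f = termA X j f + 'X^k * q
    & q`_0 = if j == 1%N then \sum_i v (D i f) *: (r i)`_0 else 0.
Proof.
move=> hX hY hXY; elim: j f => [|j IH] f.
  by exists 0; rewrite ?mulr0 ?addr0 // coef0.
have {IH} /fin_all_exists2[q hq hq0] i := IH (D i f).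
exists (\sum_i (r i * termA Y j (D i f) + X i * q i)).
  rewrite /= mulr_sumr -big_split; apply: eq_bigr => i _ /=.
  by rewrite hXY [in LHS](hq i) [in RHS](hq i); ring.
rewrite coef_sum; case: j hq hq0 => [|j] hq hq0.
  apply: eq_bigr => i _; rewrite coefD !coef0M hX mul0r addr0 coefC /=.
  by rewrite mulrC mul_polyC.
by rewrite big1 // => i _; rewrite coefD !coef0M hX taylor_term_coef0 // mul0r mulr0 addr0.
Qed.

(** With at least two Taylor terms the linear one is present, so the leading change is the
    differential of f applied to the leading change of the argument. *)
Lemma taylor_poly_perturb k N X Y r f :
  (forall i, (X i)`_0 = 0) -> (forall i, (Y i)`_0 = 0) ->
  (forall i, Y i = X i + 'X^k * r i) ->
  exists2 q, taylorA N.+2 Y f = taylorA N.+2 X f + 'X^k * q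
    & q`_0 = \sum_i v (D i f) *: (r i)`_0.
Proof.
move=> hX hY hXY.
have /fin_all_exists2[q hq hq0] (j : 'I_N.+2) := taylor_term_perturb j f hX hY hXY.
exists (\sum_(j < N.+2) cst2 (j`!%:R)^-1 * q j).
  rewrite mulr_sumr -big_split; apply: eq_bigr => j _ /=.
  by rewrite hq; ring.
rewrite coef_sum big_ord_recl big_ord_recl big1 => [|j _].
  rewrite !coef0M !hq0 /= mulr0 add0r addr0 coefC /= invr1.
  by rewrite mul1r.
by rewrite coef0M hq0 /= mulr0.
Qed.

End TaylorPolynomials.

(** * The system at each order *)

Section OrderSystem.
Variables (R : numFieldType) (m : nat) (T : Type).
Variables (v : T -> R) (D : 'I_m -> T -> T) (N : nat).

(* The coefficients of one power of delta. *)
Record state := State {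
  sxi : 'rV[{poly R}]_m;
  sp : {poly R}; sb : {poly R}; sy : {poly R};
  sv : {poly R}; sz : {poly R}; sl : {poly R} }.

Definition gen (g : state -> {poly R}) (u : nat -> state) (k : nat)
  : {poly {poly R}} := \poly_(j < k) g (u j).

Definition Xi u k (i : 'I_m) : {poly {poly R}} :=
  'X^2 * gen (fun s => sxi s 0 i) u k.

(** The factor delta in delta z' shifts the index: order n sees the derivative of the previous z. *)
Definition zprev (u : nat -> state) n : {poly R} :=
  if n is n'.+1 then (sz (u n'))^`() else 0.

(* Right-hand side, at order n + 2 and s = 0, of the condition on the j-th component
   of (P, B, Y, V, J): delta^2 p, delta^2 b, delta^6 y, delta^4 v, 0. *)
Definition rhs (u : nat -> state) n (j : nat) : {poly R} :=
  match j with
  | 0 => sp (u n)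
  | 1 => sb (u n)
  | 2 => if (4 <= n)%N then sy (u (n - 4)%N) else 0
  | 3 => if (2 <= n)%N then sv (u (n - 2)%N) else 0
  | _ => 0
  end.

Notation J := (taylor_poly v D (@cst2 R) N.+2).

Variables (F G Phi : 'I_m -> T) (A1 A2 A3 : T).

(* [k > n] is the number of terms kept in the series. *)
Record order_eqs (k n : nat) (u : nat -> state) : Prop := OrderEqs {
  oe_xi : forall i, (sxi (u n) 0 i)^`() =
    (J (Xi u k) (F i) + J (Xi u k) (G i) * gen sl u k)`_n;
  oe_p : (sp (u n))^`() = (J (Xi u k) A1)`_n;
  oe_b : (sb (u n))^`() = (J (Xi u k) A2 - J (Xi u k) A3 * gen sl u k)`_n;
  oe_y : (sy (u n))^`() = sv (u n);
  oe_v : (sv (u n))^`() = sb (u n) + (gen sp u k * gen sl u k)`_n;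
  oe_z : zprev u n = - sz (u n) - sl (u n);
  oe_l : sl (u n) = sz (u n) - sy (u n);
  oe_p0 : (sp (u n)).[0] = 0;
  oe_Phi : forall j, ((J (Xi u k) (Phi j))`_n.+2).[0] = (rhs u n j).[0] }.

(* The parts of v' and b' at order n that do not involve b_n and lambda_n. *)
Definition v_known u n := (gen sp u n * gen sl u n)`_n + sp (u n) * (gen sl u n)`_0.
Definition b_known u n := (J (Xi u n) A2 - J (Xi u n) A3 * gen sl u n)`_n.

(* [order_eqs] with the unknowns of order [n] separated from the lower ones. The
   factor [sp (u 0)] is left as it is, since for [n = 0] it is itself unknown. *)
Record lin_eqs (n : nat) (u : nat -> state) : Prop := LinEqs {
  le_xi : forall i, (sxi (u n) 0 i)^`() =
    (J (Xi u n) (F i) + J (Xi u n) (G i) * gen sl u n)`_n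
    + v (G i) *: sl (u n);
  le_p : (sp (u n))^`() = (J (Xi u n) A1)`_n;
  le_b : (sb (u n))^`() = b_known u n - v A3 *: sl (u n);
  le_y : (sy (u n))^`() = sv (u n);
  le_v : (sv (u n))^`() = sb (u n) + (v_known u n + sp (u 0%N) * sl (u n));
  le_z : zprev u n = - sz (u n) - sl (u n);
  le_l : sl (u n) = sz (u n) - sy (u n);
  le_p0 : (sp (u n)).[0] = 0;
  le_Phi : forall j, ((J (Xi u n) (Phi j))`_n.+2).[0]
    + \sum_i v (D i (Phi j)) * (sxi (u n) 0 i).[0] = (rhs u n j).[0] }.

Lemma coefXnMn n (q : {poly {poly R}}) : ('X^n * q)`_n = q`_0.
Proof. by rewrite coefXnM ltnn subnn. Qed.

Lemma gen_cut g u k n : (n < k)%N ->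
  exists2 q, gen g u k = gen g u n + 'X^n * q & q`_0 = g (u n).
Proof.
move=> hn; exists (\poly_(j < k - n) g (u (n + j)%N)); last first.
  by rewrite coef_poly subn_gt0 hn addn0.
apply/polyP => j; rewrite coefD coefXnM !coef_poly.
case: (ltnP j n) => [hj|hj]; first by rewrite (ltn_trans hj hn) addr0.
by rewrite add0r subnKC // ltn_sub2rE.
Qed.

Lemma Xi0 u k i : (Xi u k i)`_0 = 0.
Proof. by rewrite coefXnM. Qed.

(** Because of the factor delta^2 in [Xi], the unknown xi_n is first felt at order n + 2, and there
    linearly. *)
Lemma taylor_cut u k n f : (n < k)%N ->
  exists2 q, J (Xi u k) f = J (Xi u n) f + 'X^(n.+2) * q
    & q`_0 = \sum_i v (D i f) *: sxi (u n) 0 i.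
Proof.
move=> hn.
have /fin_all_exists2[r hr hr0] i := gen_cut (fun s => sxi s 0 i) u hn.
have [i|q hq hq0] := taylor_poly_perturb v D (k := n.+2) (r := r) N f (Xi0 u n) (Xi0 u k).
  by rewrite /Xi hr mulrDr mulrA -exprD.
by exists q => //; rewrite hq0; apply: eq_bigr => i _; rewrite hr0.
Qed.

(** At order n the smooth coefficients involve lower unknowns only, so lambda_n meets just their
    values at the base point. The conditions at s = 0 are read at order n + 2, where xi_n enters
    through the gradients. *)
Lemma order_eqsE k n u : (n < k)%N -> order_eqs k n u <-> lin_eqs n u.
Proof.
move=> hn; have [ql hql hql0] := gen_cut sl u hn.
have [qp hqp hqp0] := gen_cut sp u hn.
have Jn f : (J (Xi u k) f)`_n = (J (Xi u n) f)`_n.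
  have [q -> _] := taylor_cut u f hn.
  by rewrite coefD coefXnM leqnSn addr0.
have JMn f : (J (Xi u k) f * gen sl u k)`_n =
    (J (Xi u n) f * gen sl u n)`_n + v f *: sl (u n).
  have [q -> _] := taylor_cut u f hn.
  set X := J _ _; have X0 : X`_0 = (v f)%:P by apply: taylor_poly_coef0; apply: Xi0.
  have -> : (X + 'X^(n.+2) * q) * gen sl u k = X * gen sl u n +
     'X^n * (X * ql + 'X^2 * (q * gen sl u k)).
    by rewrite -addn2 exprD mulrDl {1}hql; ring.
  rewrite coefD coefXnMn coefD coef0M X0 hql0 coefXnM addr0.
  by rewrite mul_polyC.
have JPhi j : ((J (Xi u k) (Phi j))`_n.+2).[0] = ((J (Xi u n) (Phi j))`_n.+2).[0]
    + \sum_i v (D i (Phi j)) * (sxi (u n) 0 i).[0].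
  have [q -> hq] := taylor_cut u (Phi j) hn.
  rewrite coefD coefXnMn hq hornerD horner_sum.
  by congr (_ + _); apply: eq_bigr => i _; rewrite hornerZ.
have pl : (gen sp u k * gen sl u k)`_n = v_known u n + sp (u 0%N) * sl (u n).
  have -> : gen sp u k * gen sl u k = gen sp u n * gen sl u n +
     'X^n * (qp * gen sl u n + gen sp u k * ql).
    by rewrite hql hqp; ring.
  rewrite coefD coefXnMn coefD !coef0M hqp0 hql0.
  by rewrite addrA [(gen sp u k)`_0]coef_poly (leq_ltn_trans _ hn).
split=> -[e1 e2 e3 e4 e5 e6 e7 e8 e9]; split=> // [i||||j].
- by rewrite e1 !coefD Jn JMn addrA.
- by rewrite e2 Jn.
- by rewrite e3 /b_known !coefB Jn JMn opprD addrA.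
- by rewrite e5 pl.
- by rewrite -JPhi.
- by rewrite e1 !coefD Jn JMn addrA.
- by rewrite e2 Jn.
- by rewrite e3 /b_known !coefB Jn JMn opprD addrA.
- by rewrite e5 pl.
- by rewrite JPhi.
Qed.

(** The last two equations give y = - zp - 2 l. Differentiating three times and inserting y' = w,
    then w', then b' leaves l alone. *)
Lemma slip_elim (a1 a3 : R) (b y w z l zp q a2 : {poly R}) :
  b^`() = a2 - a3 *: l -> y^`() = w -> w^`() = b + (q + a1 *: 'X * l) ->
  zp = - z - l -> l = z - y ->
  slip_op a1 a3 l = - (zp^`(3) + a2 + q^`()).
Proof.
move=> eb ey ew ez el.
have hy : y = - zp - l *+ 2 by rewrite ez el; ring.
have : w^`()^`() = a2 - a3 *: l + (q + a1 *: 'X * l)^`().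
  by rewrite ew derivD eb.
rewrite -ey hy derivD derivM derivZ derivX !poly.derivE /= => h.
have {h} : zp^`()^`()^`() = - l^`()^`()^`() *+ 2
  - (a2 - a3 *: l + (q^`() + (a1%:A * l + a1 *: 'X * l^`()))).
  by rewrite -h; ring.
have d3 (f : {poly R}) : f^`(3) = f^`()^`()^`() by [].
rewrite /slip_op !d3 => ->.
rewrite -!mul_polyC polyCB; ring.
Qed.

(** Converse of the elimination: when b is defined by the equation for w', the reduced equation is
    exactly what makes the equation for b' hold. *)
Lemma slip_intro (a1 a3 : R) (y l zp q a2 : {poly R}) :
  slip_op a1 a3 l = - (zp^`(3) + a2 + q^`()) -> y = - zp - l *+ 2 ->
  (y^`()^`() - (q + a1 *: 'X * l))^`() = a2 - a3 *: l.
Proof.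
move=> hl ->; have d3 (f : {poly R}) : f^`(3) = f^`()^`()^`() by [].
have {}hl : 2%:R *: l^`()^`()^`() = - (zp^`()^`()^`() + a2 + q^`())
    - (a1 - a3) *: l - a1 *: ('X * l^`()).
  by move: hl; rewrite /slip_op !d3 => <-; ring.
rewrite !(derivD, derivN, derivM, derivZ, derivX, derivMn).
have -> : - (l^`()^`()^`() *+ 2) = - (2%:R *: l^`()^`()^`()) by rewrite scaler_nat.
by rewrite hl -!mul_polyC polyCB; ring.
Qed.

(** * Solving the orders one after another *)

Section Solve.
Variables (a1 a3 : R).
Hypothesis ha : forall d : nat, a1 * d.+1%:R != a3.
Hypotheses (ha1 : v A1 = a1) (ha3 : v A3 = a3).
Let DM := \matrix_(i, j) v (D i (Phi j)).
Hypothesis DMu : DM \in unitmx.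

Definition slip_rhs u n := - ((zprev u n)^`(3) + b_known u n + (v_known u n)^`()).

Lemma lin_slip n u : sp (u 0%N) = a1 *: 'X -> lin_eqs n u ->
  slip_op a1 a3 (sl (u n)) = slip_rhs u n.
Proof.
move=> hp [_ _ eb ey ev ez el _ _]; rewrite hp in ev; rewrite ha3 in eb.
exact: slip_elim eb ey ev ez el.
Qed.

(** At order 0 a Taylor polynomial contributes only its value at the base point, so p_0 integrates a
    constant. This supplies the coefficient a1 s of lambda_n in the equation for v'. *)
Lemma lin_p0 u : lin_eqs 0 u -> sp (u 0%N) = a1 *: 'X.
Proof.
move=> [_ ep _ _ _ _ _ ep0 _]; apply: deriv_inj; last first.
  by rewrite ep0 hornerZ hornerX mulr0.
by rewrite ep taylor_poly_coef0 ?ha1 ?derivZ ?derivX ?alg_polyC // => i; apply: Xi0.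
Qed.

(** The conditions at s = 0 form a linear system for the row xi_n(0) with the Jacobian as matrix. *)
Lemma lin_xi0 n u : lin_eqs n u ->
  (\row_i (sxi (u n) 0 i).[0]) =
  (\row_j ((rhs u n j).[0] - ((J (Xi u n) (Phi j))`_n.+2).[0])) *m invmx DM.
Proof.
move=> [_ _ _ _ _ _ _ _ h]; rewrite -[LHS](mulmxK DMu); congr (_ *m _).
apply/rowP => j; rewrite !mxE -h [RHS]addrC addKr; apply: eq_bigr => i _.
by rewrite !mxE mulrC.
Qed.

Lemma eq_gen g u u' n : (forall j, (j < n)%N -> u j = u' j) ->
  gen g u n = gen g u' n.
Proof. by move=> h; apply: eq_poly => j /h ->. Qed.

Lemma eq_Xi u u' n : (forall j, (j < n)%N -> u j = u' j) ->
  Xi u n =1 Xi u' n.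
Proof. by move=> h i; rewrite /Xi (eq_gen _ h). Qed.

Lemma eq_zprev u u' n : (forall j, (j < n)%N -> u j = u' j) ->
  zprev u n = zprev u' n.
Proof. by case: n => //= n ->. Qed.

Lemma eq_rhs u u' n j : (forall j, (j <= n)%N -> u j = u' j) ->
  rhs u n j = rhs u' n j.
Proof.
by move=> h; case: j => [|[|[|[|]]]] //=; rewrite ?h ?leq_subr.
Qed.

(** The unknowns are determined in the order p, lambda, z, y, v, b, xi, each from the lower orders
    and those before it. *)
Lemma lin_unique n u u' : (forall j, (j < n)%N -> u j = u' j) ->
  sp (u 0%N) = a1 *: 'X -> sp (u' 0%N) = a1 *: 'X ->
  lin_eqs n u -> lin_eqs n u' -> u n = u' n.
Proof.
move=> huu hp hp' h h'.
have hG g := eq_gen g huu; have hZ := eq_zprev huu.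
have hJ f : J (Xi u n) f = J (Xi u' n) f by apply/eq_taylor_poly/eq_Xi.
have hbk : b_known u n = b_known u' n by rewrite /b_known !hJ hG.
have ep : sp (u n) = sp (u' n).
  by apply: deriv_inj; rewrite ?(le_p h) ?(le_p h') ?(le_p0 h) ?(le_p0 h') ?hJ.
have hvq : v_known u n = v_known u' n by rewrite /v_known !hG ep.
have el : sl (u n) = sl (u' n).
  apply: (slip_op_inj ha); rewrite (lin_slip hp h) (lin_slip hp' h').
  by rewrite /slip_rhs hZ hbk hvq.
have ez : sz (u n) = sz (u' n).
  have := le_z h; rewrite hZ (le_z h') el => /addIr/oppr_inj; exact: esym.
have ey : sy (u n) = sy (u' n).
  by have := le_l h; rewrite el (le_l h') ez => /addrI/oppr_inj.
have ev : sv (u n) = sv (u' n) by rewrite -(le_y h) -(le_y h') ey.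
have eb : sb (u n) = sb (u' n).
  by have := le_v h; rewrite ev (le_v h') hp hp' hvq el => /addIr.
(* At order n, [rhs] reads p and b, just shown equal, and y and v only from strictly lower
   orders. *)
have er j : rhs u n j = rhs u' n j.
  case: j => [|[|[|[|j]]]] //=; case: leqP => // h0; rewrite huu //; lia.
have exi : sxi (u n) = sxi (u' n).
  apply/rowP => i; apply: deriv_inj.
    by rewrite (le_xi h) (le_xi h') !hJ hG el.
  have /rowP/(_ i) := lin_xi0 h; rewrite mxE => ->.
  have /rowP/(_ i) := lin_xi0 h'; rewrite [in LHS]mxE => ->.
  by congr ((_ *m _) _ _); apply/rowP => j; rewrite !mxE er hJ.
case: (u n) (u' n) exi ep eb ey ev ez el => [? ? ? ? ? ? ?] [? ? ? ? ? ? ?] /=.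
by move=> -> -> -> -> -> -> ->.
Qed.

Definition upd (u : nat -> state) n w j := if j == n then w else u j.

Lemma upd_lt u n w j : (j < n)%N -> u j = upd u n w j.
Proof. by move=> h; rewrite /upd ltn_eqF. Qed.

Lemma lin_exists n u : n = 0%N \/ sp (u 0%N) = a1 *: 'X ->
  exists w, lin_eqs n (upd u n w).
Proof.
move=> hn; pose J0 f := J (Xi u n) f.
pose p := integ (J0 A1)`_n.
pose q := (gen sp u n * gen sl u n)`_n + p * (gen sl u n)`_0.
pose b0 := b_known u n.
have [l hl _] := slip_op_surj ha (- ((zprev u n)^`(3) + b0 + q^`())).
pose z := - zprev u n - l; pose y := z - l.
pose b := y^`()^`() - (q + a1 *: 'X * l).
(* A provisional state for evaluating [rhs], which never reads the xi component; the row 0 is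
   arbitrary. *)
pose w0 := State 0 p b y y^`() z l.
pose c := (\row_j ((rhs (upd u n w0) n j).[0] - ((J0 (Phi j))`_n.+2).[0]))
   *m invmx DM.
pose fx i := (J0 (F i) + J0 (G i) * gen sl u n)`_n + v (G i) *: l.
exists (State (\row_i (integ (fx i) + (c 0 i)%:P)) p b y y^`() z l).
set w := State _ _ _ _ _ _ _.
have huu := upd_lt u w (n := n).
have hG g : gen g (upd u n w) n = gen g u n by rewrite (eq_gen _ huu).
have hZ : zprev (upd u n w) n = zprev u n by rewrite (eq_zprev huu).
have hJ f : J (Xi (upd u n w) n) f = J0 f by apply/esym/eq_taylor_poly/eq_Xi.
have un : upd u n w n = w by rewrite /upd eqxx.
(* For n = 0 this concerns the p just constructed, otherwise the hypothesis on the lower orders. *)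
have hp : sp (upd u n w 0%N) = a1 *: 'X.
  rewrite /upd; case: eqVneq => [n0|/eqP n0]; last by case: hn => // /esym.
  rewrite /= /p -n0 taylor_poly_coef0 => [|i]; last exact: Xi0.
  apply: deriv_inj; last by rewrite integ0 hornerZ hornerX mulr0.
  by rewrite deriv_integ ha1 derivZ derivX alg_polyC.
have hq : v_known (upd u n w) n = q by rewrite /v_known !hG un.
have hb : b_known (upd u n w) n = b0 by rewrite /b_known !hJ hG.
have hr j : rhs (upd u n w) n j = rhs (upd u n w0) n j.
  case: j => [|[|[|[|j]]]] //=; rewrite ?un ?/upd ?eqxx //.
    by case: leqP => // h; case: eqP.
  by case: leqP => // h; case: eqP.
split; rewrite ?hZ ?hb ?hq ?hp un /=.
- move=> i; rewrite !hJ hG mxE derivD derivC addr0 deriv_integ //.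
- by rewrite hJ deriv_integ.
- by rewrite ha3; apply: (slip_intro (zp := zprev u n)) => //; rewrite /y /z; ring.
- by [].
- by rewrite subrK.
- by rewrite /z; ring.
- by rewrite /y; ring.
- exact: integ0.
- move=> j; rewrite hJ hr.
  have : c *m DM = \row_j ((rhs (upd u n w0) n j).[0] - ((J0 (Phi j))`_n.+2).[0]).
    by rewrite /c mulmxKV.
  move/rowP/(_ j); rewrite [in RHS]mxE => h.
  rewrite -[RHS](subrK ((J0 (Phi j))`_n.+2).[0]) -h addrC mxE; congr (_ + _).
  apply: eq_bigr => i _.
  by rewrite !mxE hornerD integ0 add0r hornerC mulrC.
Qed.

Lemma lin_congr n u u' : (forall j, (j <= n)%N -> u j = u' j) ->
  lin_eqs n u -> lin_eqs n u'.
Proof.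
move=> h hl; have un := h n (leqnn n); have u0 := h 0%N (leq0n n).
have huu j : (j < n)%N -> u j = u' j by move=> hj; apply: h; apply: ltnW.
have hG g := eq_gen g huu; have hZ := eq_zprev huu.
have hJ f : J (Xi u n) f = J (Xi u' n) f by apply/eq_taylor_poly/eq_Xi.
have hbk : b_known u n = b_known u' n by rewrite /b_known !hJ hG.
have hvq : v_known u n = v_known u' n by rewrite /v_known !hG un.
case: hl => e1 e2 e3 e4 e5 e6 e7 e8 e9; split => [i|||||||| j].
- by rewrite -un -hG -!hJ.
- by rewrite -un -hJ.
- by rewrite -un -hbk.
- by rewrite -un.
- by rewrite -un -u0 -hvq.
- by rewrite -un -hZ.
- by rewrite -un.
- by rewrite -un.
- by rewrite -un -hJ -(eq_rhs j h).
Qed.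

Lemma weightS n : weight n.+1 = if odd n then weight n + 5 else weight n - 4.
Proof. by rewrite /weight /= uphalf_half; case: odd => /=; lia. Qed.

(** For n = 2 nu + 1 the equation for z_n contains the derivative of z_(2 nu), which lies in P_(nu -
    1): 3 above the weight nu - 4. The third derivative of that term in the reduced equation brings
    lambda_n back to the weight. *)
Definition weight_y n : int := weight n + (3 * odd n)%N.

Record order_pattern (n : nat) (w : state) : Prop := Pat {
  pat_xi : forall i, inP (weight n + 1) (sxi w 0 i);
  pat_p : inP (weight n + 1) (sp w);
  pat_b : inP (weight n + 1) (sb w);
  pat_y : inP (weight_y n) (sy w);
  pat_v : inP (weight_y n - 1) (sv w);
  pat_z : inP (weight_y n) (sz w);
  pat_l : inP (weight n) (sl w) }.

Lemma inP_eq n n' (f : {poly R}) : inP n f -> n = n' -> inP n' f.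
Proof. by move=> h <-. Qed.

Lemma graded_gen a g u n k : (forall j, (j < n)%N -> inP (weight j + a) (g (u j))) ->
  graded a k (gen g u n).
Proof.
move=> h j _; rewrite coef_poly; case: ltnP => [/h //|_]; exact: inP0.
Qed.

Lemma graded_Xi u n k i : (forall j, (j < n)%N -> order_pattern j (u j)) ->
  graded 0 k (Xi u n i).
Proof.
move=> h j _; rewrite coefXnM; case: ltnP => hj; first exact: inP0.
have hg : graded 1 j (gen (fun s => sxi s 0 i) u n).
  by apply: graded_gen => l hl; case: (h l hl) => hxi _ _ _ _ _ _; apply: hxi.
move/(_ (j - 2)%N) in hg; case: j hj hg => [//|[//|j]] _; rewrite subn2 /= => hg.
by apply: inP_eq (hg _) _; rewrite ?weightS2 ?addr0.
Qed.

(** Integration raises every exponent by one; only the constant of integration has to be controlled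
    separately. *)
Lemma inP_prim n (f : {poly R}) :
  inP n f^`() -> inP (n + 1) (f.[0])%:P -> inP (n + 1) f.
Proof.
move=> hf h0 [|i] hi; first by apply: h0; rewrite coefC /= horner_coef0.
have [|t ->] := hf i; first by rewrite coef_deriv mulrn_eq0.
by exists t; lia.
Qed.

(** Follows the same order of determination as uniqueness. The bound on lambda_n comes from the
    graded solution of the reduced equation, which injectivity identifies with lambda_n. *)
Lemma lin_pat n u : (forall j, (j < n)%N -> order_pattern j (u j)) ->
  sp (u 0%N) = a1 *: 'X -> lin_eqs n u -> order_pattern n (u n).
Proof.
move=> hpat hp h.
have hJ k f : graded 0 k (J (Xi u n) f).
  by apply: graded_taylor => i; apply: graded_Xi.
have hL k : graded 0 k (gen sl u n).
  by apply: graded_gen => j /hpat /pat_l; rewrite addr0.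
have hP k : graded 1 k (gen sp u n).
  by apply: graded_gen => j /hpat /pat_p.
have hw0 a X : graded a n.+1 X -> inP (weight n + a) X`_n by apply.
(* The first bound serves z_n and y_n; the second serves the reduced equation, where this term is
   differentiated three times. *)
have hz : inP (weight_y n) (zprev u n) /\ inP (weight n + 3) (zprev u n).
  case: (n) hpat => [|k] hk; first by split; apply: inP0.
  have [_ _ _ _ _ hz _] := hk k (ltnSn k); move/inP_deriv in hz.
  split.
    apply: inP_eq (inP_shift (odd k) hz) _.
    by rewrite /weight_y weightS /=; case: odd => /=; lia.
  apply: inP_eq (inP_shift (odd k).*2 hz) _.
  by rewrite /weight_y weightS; case: odd => /=; lia.
case: hz => hzy hz3.
have hp1 : inP (weight n + 1) (sp (u n)).
  apply: inP_prim; last by rewrite (le_p0 h); apply: inP0.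
  by rewrite (le_p h) -[weight n]addr0; apply: hw0.
have hbk : inP (weight n) (b_known u n).
  rewrite -[weight n]addr0; apply: hw0; apply: gradedB => //.
  exact: (gradedM (a := 0) (b := 0)).
have hl0 : inP 0 (gen sl u n)`_0.
  by have := hL n.+1 0%N isT; rewrite addr0.
have hvq : inP (weight n + 1) (v_known u n).
  apply: inPD; first by apply: hw0; rewrite -[1]addr0; apply: gradedM.
  by rewrite -[_ + 1]addr0; apply: inPM.
have hl : inP (weight n) (sl (u n)).
  have [g hg hgP] := slip_op_surj ha (slip_rhs u n).
  have -> : sl (u n) = g by apply: (slip_op_inj ha); rewrite hg (lin_slip hp h).
  apply: hgP; apply: inPN; apply: inPD; first apply: inPD => //.
    by apply: inP_eq (inP_deriv (inP_deriv (inP_deriv hz3))) _; lia.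
  by apply: inP_eq (inP_deriv hvq) _; lia.
have hly : inP (weight_y n) (sl (u n)) by apply: inP_shift.
have hzz : inP (weight_y n) (sz (u n)).
  have -> : sz (u n) = - zprev u n - sl (u n) by rewrite (le_z h); ring.
  by apply: inPB => //; apply: inPN.
have hyy : inP (weight_y n) (sy (u n)).
  have -> : sy (u n) = sz (u n) - sl (u n) by rewrite (le_l h); ring.
  exact: inPB.
have hv : inP (weight_y n - 1) (sv (u n)) by rewrite -(le_y h); apply: inP_deriv.
(* The second derivative of y_n lies in P_(nu - 2) for n = 2 nu, one step of 3 below the target, and
   in P_(nu - 3) for n = 2 nu + 1, exactly the target. *)
have hb : inP (weight n + 1) (sb (u n)).
  have -> : sb (u n) = (sv (u n))^`() - (v_known u n + sp (u 0%N) * sl (u n)).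
    by rewrite (le_v h); ring.
  apply: inPB; first by apply: inP_eq (inP_shift (~~ odd n) (inP_deriv hv)) _;
    rewrite /weight_y; case: odd => /=; lia.
  apply: inPD => //; rewrite hp addrC; apply: inPM => //.
  exact/inPZ/inPX.
split=> // i; apply: inP_prim.
  rewrite (le_xi h); apply: inPD; last exact: inPZ.
  rewrite -[weight n]addr0; apply: hw0; apply: gradedD => //.
  exact: (gradedM (a := 0) (b := 0)).
have /rowP/(_ i) := lin_xi0 h; rewrite mxE => ->.
rewrite mxE rmorph_sum; apply: inP_sum => j _.
rewrite mxE mulrC rmorphM /= mul_polyC; apply: inPZ.
rewrite rmorphB /= !horner_coef0; apply: inPB; apply: inP_coef0; last first.
  by apply: inP_eq (hJ n.+3 _ n.+2 (ltnSn _)) _; rewrite weightS2; lia.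
(* The entries y_(n-4) and v_(n-2) both lie in P_(nu - 2) for n = 2 nu, hence in P_(nu + 1), and in
   P_(nu - 3) for n = 2 nu + 1. *)
case: (nat_of_ord j) => [|[|[|[|l]]]] //=; last exact: inP0.
  case: leqP => hn; first exact: inP0.
  have [|_ _ _ hy4 _ _ _] := hpat (n - 4)%N; first by lia.
  apply: inP_eq (inP_shift (~~ odd (n - 4)) hy4) _.
  by rewrite -[in weight n](subnK hn) addn4 !weightS2 /weight_y; case: odd => /=; lia.
case: leqP => hn; first exact: inP0.
have [|_ _ _ _ hv2 _ _] := hpat (n - 2)%N; first by lia.
apply: inP_eq (inP_shift (~~ odd (n - 2)) hv2) _.
by rewrite -[in weight n](subnK hn) addn2 !weightS2 /weight_y; case: odd => /=; lia.
Qed.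

Lemma solution_exists k :
  exists u, forall n, (n < k)%N -> lin_eqs n u /\ order_pattern n (u n).
Proof.
elim: k => [|k [u hu]]; first by exists (fun=> State 0 0 0 0 0 0 0).
have [|w hw] := @lin_exists k u.
  by case: (k) hu => [|k'] hu; [left | right; apply: lin_p0; apply: (hu 0%N _).1].
have hup n (hn : (n < k)%N) : lin_eqs n (upd u k w) /\ order_pattern n (upd u k w n).
  have [hl hp] := hu n hn; split; last by rewrite -upd_lt.
  by apply: lin_congr hl => j hj; apply: upd_lt; apply: leq_ltn_trans hj hn.
have hp0 : sp (upd u k w 0%N) = a1 *: 'X.
  apply: lin_p0; case: (posnP k) => [k0|/hup[] //].
  by rewrite -[X in lin_eqs X]k0.
exists (upd u k w) => n; rewrite ltnS leq_eqVlt => /predU1P[->|/hup //].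
split=> //; apply: lin_pat => // j hj; exact: (hup j hj).2.
Qed.

Lemma solution_unique k u u' : (forall n, (n < k)%N -> lin_eqs n u) ->
  (forall n, (n < k)%N -> lin_eqs n u') -> forall n, (n < k)%N -> u n = u' n.
Proof.
move=> h h'; elim/ltn_ind => n IH hn; apply: lin_unique; auto.
- by move=> j hj; apply: IH => //; apply: ltn_trans hj hn.
- by apply: lin_p0; apply: h; apply: leq_ltn_trans hn.
- by apply: lin_p0; apply: h'; apply: leq_ltn_trans hn.
Qed.

End Solve.

End OrderSystem.

Lemma taylor_poly_at0 (R : numFieldType) (m : nat) (T : Type) (v : T -> R)
    (D : 'I_m -> T -> T) N f :
  taylor_poly v D (@cst2 R) N.+1 (fun=> 0) f = cst2 (v f).
Proof.
rewrite /taylor_poly big_ord_recl big1 => [|j _]; last first.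
  by rewrite /= big1 ?mulr0 // => i _; rewrite mul0r.
by rewrite addr0 /= fact0 invr1 /cst2 !polyC1 mul1r.
Qed.

(** The argument starts at delta^2, so nothing appears at order 1. This disposes of that order in
    the conditions at s = 0. *)
Lemma taylor_Xi_coef1 (R : numFieldType) (m : nat) (T : Type) (v : T -> R)
    (D : 'I_m -> T -> T) N u k f :
  (taylor_poly v D (@cst2 R) N.+2 (Xi u k) f)`_1 = 0.
Proof.
have [i|i|i|q -> _] := @taylor_poly_perturb R m T v D 2 N (fun=> 0) (Xi u k)
    (fun i => gen (fun s => sxi s 0 i) u k) f.
- by rewrite coef0.
- exact: Xi0.
- by rewrite add0r.
by rewrite taylor_poly_at0 coefD coefXnM coefC addr0.
Qed.

Local Open Scope classical_set_scope.
Local Open Scope ring_scope.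

(** * Taylor expansion *)

Section C1.
Variable R : realType.

Lemma mean_value_bound (phi dphi : R -> R) (K t : R) :
  (forall c, is_derive c (1 : R) phi (dphi c)) ->
  (forall c, `|c| <= `|t| -> `|dphi c| <= K) ->
  `|phi t - phi 0| <= K * `|t|.
Proof.
move=> hd hK.
have hc a b : {within `[a, b], continuous phi}.
  apply: continuous_subspaceT => c; apply/differentiable_continuous.
  by apply/derivable1_diffP; have [] := hd c.
have [t0|t0] := leP 0 t.
  have [c] := MVT_segment t0 (fun x _ => hd x) (hc _ _).
  rewrite in_itv /= => /andP[c0 ct] ->; rewrite subr0 normrM ler_wpM2r //.
  by apply: hK; rewrite !ger0_norm.
have [c] := MVT_segment (ltW t0) (fun x _ => hd x) (hc _ _).
rewrite in_itv /= => /andP[c0 ct]; rewrite distrC => ->.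
rewrite sub0r normrM normrN ler_wpM2r //.
by apply: hK; rewrite !ler0_norm ?lerN2 // ltW.
Qed.

Lemma is_derive_line (V W : normedModType R) (f : V -> W) (a w : V) (t : R) :
  derivable f (a + t *: w) w ->
  is_derive t (1 : R) (fun s => f (a + s *: w)) ('D_w f (a + t *: w)).
Proof.
move=> hf.
have e : (fun h : R => h^-1 *: (((fun s => f (a + s *: w)) \o shift t) (h *: (1 : R)) -
    f (a + t *: w))) =
  (fun h => h^-1 *: ((f \o shift (a + t *: w)) (h *: w) - f (a + t *: w))).
  apply/funext => h /=; congr (_ *: (f _ - _)).
  by rewrite [h *: (1 : R)]mulr1 scalerDl addrCA.
by split; rewrite /derivable /derive e.
Qed.

Variable m : nat.
Implicit Types (f : 'rV[R]_m -> R) (x h : 'rV[R]_m).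

Definition pd (i : 'I_m) f : 'rV[R]_m -> R := fun x => 'D_(delta_mx 0 i) f x.

Lemma norm_coord h i : `|h 0 i| <= `|h|.
Proof.
rewrite [leRHS]/Num.Def.normr /= mx_normrE.
by apply: (le_bigmax _ (fun ij : 'I_1 * 'I_m => `|h ij.1 ij.2|) (0, i)).
Qed.

Lemma norm_row_le h (e : R) : 0 <= e -> (forall i, `|h 0 i| <= e) -> `|h| <= e.
Proof.
move=> e0 he; rewrite [leLHS]/Num.Def.normr /= mx_normrE.
by apply: bigmax_le => //= -[i j] _; rewrite (ord1 i).
Qed.

Lemma continuous_big (T : topologicalType) (n : nat) (g : 'I_n -> T -> R) :
  (forall i, continuous (g i)) -> continuous (fun y => \sum_i g i y).
Proof.
move=> hg.
have -> : (fun y => \sum_i g i y) = \sum_i g i.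
  by apply/funext => y; rewrite fct_sumE.
apply: (big_ind (fun h : T -> R => continuous h)) => // [y|F G hF hG y].
  exact: cvg_cst.
by apply: cvgD; [exact: hF | exact: hG].
Qed.

Definition lin_form (g : 'I_m -> R) (h : 'rV[R]_m) : R^o := \sum_i h 0 i * g i.

Lemma lin_form_is_linear g : linear (lin_form g).
Proof.
move=> a u w; rewrite /lin_form scaler_sumr -big_split; apply: eq_bigr => i _ /=.
by rewrite !mxE mulrDl scalerAl.
Qed.

HB.instance Definition _ g :=
  GRing.isLinear.Build R 'rV[R]_m R^o *:%R (lin_form g) (lin_form_is_linear g).

Lemma lin_form_continuous g : continuous (lin_form g).
Proof.
apply: (@continuous_big _ _ (fun i (h : 'rV[R]_m) => h 0 i * g i)) => i x.
apply: (@continuousM _ _ (fun h : 'rV[R]_m => h 0 i) (cst (g i)) x).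
  exact: coord_continuous.
exact: cst_continuous.
Qed.

(** The differential is picked by choice among continuous linear first-order approximations, so
    exhibiting one suffices. *)
Lemma differentiable_intro (V W : normedModType R) (f : V -> W)
    (df : {linear V -> W}) (x : V) :
  continuous df ->
  (forall e : R, 0 < e -> \forall h \near (0 : V),
     `|f (h + x) - f x - df h| <= e * `|h|) ->
  differentiable f x.
Proof.
move=> dfc hf.
have H : f = (fun y => f x + df (y - x)) +o_x (fun y => y - x).
  apply/eqaddoP => e e0; rewrite [\forall x \near _, _ <= _](near_shift 0) subr0.
  move: (hf e e0).
  by apply: filterS => h /=; rewrite !fctE /= addrK opprD addrA.
apply/diffP => /=.
apply: (@getPex _ (fun (df : {linear V -> W}) => continuous df /\
  forall y, f y = f (lim (nbhs x)) + df (y - lim (nbhs x))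
                  +o_(y \near x) (y - lim (nbhs x)))).
exists df; split=> //= y; rewrite lim_id //.
by rewrite {1}H.
Qed.

Lemma C1_differentiable f x :
  (forall i y, derivable f y (delta_mx 0 i)) ->
  (forall i, continuous (pd i f)) -> differentiable f x.
Proof.
move=> hd hc.
apply: (differentiable_intro (df := lin_form (fun i => pd i f x))).
  exact: lin_form_continuous.
(* Dividing by m + 1 covers m = 0; the surplus summand is dropped further down. *)
move=> e e0; pose e1 := e / m.+1%:R.
have e10 : 0 < e1 by rewrite divr_gt0.
have : \forall y \near x, forall i, `|pd i f x - pd i f y| <= e1.
  apply: (@filter_forall _ _ (fun i y => `|pd i f x - pd i f y| <= e1) _
    (nbhs_filter x)) => i.
  by move/cvgrPdist_le: (hc i x); apply.
rewrite [\forall x \near _, _](near_shift 0) subr0 => /nbhs_normP[/= d d0 hy].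
apply/nbhs_normP; exists d => //= h /=; rewrite sub0r normrN => hh.
(* Keeping the first k coordinates of h gives a path from 0 to h that changes one coordinate at a
   time. *)
pose hk k : 'rV[R]_m := \row_i (if (i < k)%N then h 0 i else 0).
have hm : hk m = h by apply/rowP => i; rewrite mxE ltn_ord.
have h0 : hk 0%N = 0 by apply/rowP => i; rewrite !mxE.
have hS (k : 'I_m) : hk k.+1 = hk k + h 0 k *: delta_mx 0 k.
  apply/rowP => i; rewrite !mxE /= ltnS leq_eqVlt -val_eqE /=.
  case: eqVneq => [/val_inj->|] /=; first by rewrite ltnn mulr1 add0r.
  by rewrite mulr0 addr0.
have hb (k : 'I_m) c : `|c| <= `|h 0 k| -> `|hk k + c *: delta_mx 0 k| <= `|h|.
  move=> ck; apply: norm_row_le => // j; rewrite !mxE /=.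
  case: eqVneq => [->|_]; last first.
    by rewrite mulr0 addr0; case: ifP; rewrite ?normr0 // norm_coord.
  by rewrite mulr1 ltnn add0r (le_trans ck) // norm_coord.
have -> : f (h + x) - f x = \sum_(k < m) (f (x + hk k.+1) - f (x + hk k)).
  rewrite -(big_mkord xpredT (fun k => f (x + hk k.+1) - f (x + hk k))).
  by rewrite (telescope_sumr (fun k => f (x + hk k))) // hm h0 addr0 [x + h]addrC.
rewrite /lin_form /= -sumrB (le_trans (ler_norm_sum _ _ _)) //.
have -> : e * `|h| = \sum_(k < m.+1) e1 * `|h|.
  by rewrite sumr_const card_ord -mulr_natr mulrAC /e1 divfK ?pnatr_eq0.
rewrite big_ord_recr /= -[leLHS]addr0 lerD ?mulr_ge0 ?(ltW e0) ?(ltW e10) //.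
apply: ler_sum => k _; rewrite hS addrA.
(* With the linear part subtracted, the derivative is the variation of the k-th partial derivative,
   at most e1 near x. *)
pose phi t := f (x + hk k + t *: delta_mx 0 k) - t * pd k f x.
have -> : f (x + hk k + h 0 k *: delta_mx 0 k) - f (x + hk k) - h 0 k * pd k f x
    = phi (h 0 k) - phi 0.
  by rewrite /phi scale0r mul0r !addr0 subr0 addrAC.
apply: (@le_trans _ _ (e1 * `|h 0 k|)); last first.
  by rewrite ler_wpM2l ?norm_coord // ltW.
apply: (@mean_value_bound _
  (fun t => pd k f (x + hk k + t *: delta_mx 0 k) - pd k f x)) => [c|c ck].
  apply: is_deriveB; first exact: is_derive_line.
  have := @is_deriveM _ _ id (cst (pd k f x)) c (1 : R) _ _
    (is_derive_id _ _) (is_derive_cst _ _ _).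
  by rewrite scaler0 add0r [_ *: _]mulr1.
have := hy (hk k + c *: delta_mx 0 k).
rewrite /= sub0r normrN => /(_ (le_lt_trans (hb k c ck) hh) k).
by rewrite distrC [x + _]addrC addrAC.
Qed.
End C1.

(** * Smooth functions and the Taylor remainder *)

Section SmoothCalculus.
Variables (R : realType) (m : nat).
Implicit Types (f g : 'rV[R]_m -> R).

Lemma Cr_continuous r f : Cr r f -> continuous f.
Proof. by case: r => [|r] []. Qed.

Lemma Cr_derivable r f i x : Cr r.+1 f -> derivable f x (delta_mx 0 i).
Proof. by move=> [_ /(_ i)[]]. Qed.

Lemma Cr_pd r f i : Cr r.+1 f -> Cr r (pd i f).
Proof. by move=> [_ /(_ i)[]]. Qed.

Lemma CrW r f : Cr r.+1 f -> Cr r f.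
Proof.
elim: r f => [|r IH] f [fc fd]; split=> // i; have [fi fr] := fd i.
by split=> //; apply: IH.
Qed.

Lemma Cr_cst r (c : R) : Cr r (fun _ : 'rV[R]_m => c).
Proof.
elim: r c => [|r IH] c; first by split=> // x; apply: cst_continuous.
split=> [x|i]; first exact: cst_continuous.
split=> [x|]; first exact: derivable_cst.
have -> : (fun x => 'D_(delta_mx 0 i) (fun=> c) x) = fun _ : 'rV[R]_m => 0 : R.
  by apply/funext => x; apply: derive_cst.
exact: IH.
Qed.

Lemma CrD r f g : Cr r f -> Cr r g -> Cr r (fun x => f x + g x).
Proof.
elim: r f g => [|r IH] f g hf hg.
  by split=> // x; apply: continuousD; apply: Cr_continuous; eassumption.
split=> [x|i].
  by apply: continuousD; [apply: (Cr_continuous hf) | apply: (Cr_continuous hg)].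
split=> [x|]; first by apply: (@derivableD _ _ _ f g); apply: Cr_derivable; eassumption.
have -> : (fun x => 'D_(delta_mx 0 i) (fun y => f y + g y) x) =
    fun x => pd i f x + pd i g x.
  apply/funext => x; apply: (@deriveD _ _ _ f g);
    [exact: Cr_derivable hf | exact: Cr_derivable hg].
by apply: IH; apply: Cr_pd.
Qed.

Lemma CrM r f g : Cr r f -> Cr r g -> Cr r (fun x => f x * g x).
Proof.
elim: r f g => [|r IH] f g hf hg.
  by split=> // x; apply: continuousM; apply: Cr_continuous; eassumption.
split=> [x|i].
  by apply: continuousM; [apply: (Cr_continuous hf) | apply: (Cr_continuous hg)].
split=> [x|]; first by apply: (@derivableM _ _ f g); apply: Cr_derivable; eassumption.
have -> : (fun x => 'D_(delta_mx 0 i) (fun y => f y * g y) x) =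
    fun x => f x * pd i g x + g x * pd i f x.
  apply/funext => x; apply: (@deriveM _ _ f g);
    [exact: Cr_derivable hf | exact: Cr_derivable hg].
by apply: CrD; apply: IH; do ?[exact: Cr_pd | exact: CrW].
Qed.

Lemma smooth_cst (c : R) : smooth (fun _ : 'rV[R]_m => c).
Proof. by move=> r; apply: Cr_cst. Qed.

Lemma smoothD f g : smooth f -> smooth g -> smooth (fun x => f x + g x).
Proof. by move=> hf hg r; apply: CrD. Qed.

Lemma smoothM f g : smooth f -> smooth g -> smooth (fun x => f x * g x).
Proof. by move=> hf hg r; apply: CrM. Qed.

Lemma smooth_sum n (F : 'I_n -> 'rV[R]_m -> R) :
  (forall i, smooth (F i)) -> smooth (fun x => \sum_i F i x).
Proof.
move=> hF; have -> : (fun x => \sum_i F i x) = \sum_i F i.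
  by apply/funext => x; rewrite fct_sumE.
apply: (big_ind (@smooth R m)) => // [|f g]; [exact: smooth_cst | exact: smoothD].
Qed.

Lemma smooth_pd f i : smooth f -> smooth (pd i f).
Proof. by move=> hf r; apply: Cr_pd. Qed.

Lemma smooth_differentiable f x : smooth f -> differentiable f x.
Proof.
move=> hf; apply: C1_differentiable => i y.
  exact: (Cr_derivable (hf 1%N)).
exact: (Cr_continuous (Cr_pd i (hf 1%N))).
Qed.

Lemma derive_pd f x h : smooth f -> 'D_h f x = \sum_i h 0 i * pd i f x.
Proof.
move=> hf; have hd := smooth_differentiable x hf.
rewrite deriveE // {1}(row_sum_delta h) linear_sum; apply: eq_bigr => i _.
by rewrite linearZ /pd -deriveE.
Qed.

Lemma smooth_lieD (H : 'rV[R]_m -> 'rV[R]_m) f :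
  smooth_map H -> smooth f -> smooth (lieD H f).
Proof.
move=> hH hf.
have -> : lieD H f = fun x => \sum_i H x 0 i * pd i f x.
  by apply/funext => x; apply: derive_pd.
by apply: smooth_sum => i; apply: smoothM => //; apply: smooth_pd.
Qed.

Variable x0 : 'rV[R]_m.
Notation ev := (fun f : 'rV[R]_m -> R => f x0).

(** Induction on N for all smooth f at once: the derivative in t of the remainder is the sum over i
    of h_i times the previous remainder of the i-th partial derivative. Uniformity in |t| <= 1 lets
    the mean value bound be applied at every step. *)
Lemma taylor_line N f : smooth f ->
  exists2 K : R, 0 <= K & \forall h \near (0 : 'rV[R]_m), forall t : R, `|t| <= 1 ->
    `|f (x0 + t *: h) -
      \sum_(j < N) (j`!%:R)^-1 * taylor_term ev (@pd R m) id (h 0) j f * t ^+ j|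
    <= K * `|h| ^+ N.
Proof.
elim: N f => [|N IH] f hf.
  exists (`|f x0| + 1); first by rewrite addr_ge0.
  have : \forall y \near x0, `|f x0 - f y| <= 1.
    by move/cvgrPdist_le: (Cr_continuous (hf 0%N) (x:=x0)); apply.
  rewrite [\forall x \near _, _](near_shift 0) subr0 => /nbhs_normP[/= d d0 hd].
  apply/nbhs_normP; exists d => //= h /=; rewrite sub0r normrN => hh t t1.
  rewrite big_ord0 subr0 expr0 mulr1 -[f _](subrK (f x0)) [X in `|X|]addrC.
  rewrite (le_trans (ler_normD _ _)) // lerD2l distrC [x0 + _]addrC; apply: hd.
  rewrite /= sub0r normrN normrZ (le_lt_trans _ hh) //.
  by rewrite -[leRHS]mul1r ler_wpM2r.
have /fin_all_exists2[K K0 hK] (i : 'I_m) := IH _ (smooth_pd i hf).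
exists (\sum_i K i); first exact: sumr_ge0.
have := @filter_forall _ _ _ _ (nbhs_filter (0 : 'rV[R]_m)) hK.
apply: filterS => h hi t t1.
pose c j f := (j`!%:R)^-1 * taylor_term ev (@pd R m) id (h 0) j f.
pose p N f := \poly_(j < N) c j f.
have pE n g (s : R) : \sum_(j < n) (j`!%:R)^-1 *
    taylor_term ev (@pd R m) id (h 0) j g * s ^+ j = (p n g).[s].
  by rewrite horner_poly.
rewrite pE.
pose phi s := f (x0 + s *: h) - (p N.+1 f).[s].
pose dphi s := \sum_i h 0 i * (pd i f (x0 + s *: h) - (p N (pd i f)).[s]).
have dp : (p N.+1 f)^`() = \sum_i h 0 i *: p N (pd i f).
  apply/polyP => j; rewrite coef_deriv coef_sum coef_poly ltnS.
  under eq_bigr do rewrite coefZ coef_poly.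
  case: ltnP => hj; last by rewrite mul0rn big1 // => i _; rewrite mulr0.
  have e : (j.+1`!%:R : R)^-1 * j.+1%:R = (j`!%:R)^-1.
    by rewrite factS natrM invfM mulrAC mulVf ?mul1r // pnatr_eq0.
  rewrite /c -mulrnAl -[_ *+ j.+1]mulr_natr e /= mulr_sumr.
  by apply: eq_bigr => i _; rewrite mulrCA.
have phi' s : is_derive s (1 : R) phi (dphi s).
  have -> : dphi s = 'D_h f (x0 + s *: h) - (p N.+1 f)^`().[s].
    rewrite derive_pd // dp horner_sum -sumrB; apply: eq_bigr => i _.
    by rewrite mulrBr hornerZ.
  apply: is_deriveB; apply: is_derive_line.
  exact/diff_derivable/smooth_differentiable.
have phi0 : phi 0 = 0.
  rewrite /phi scale0r addr0 horner_coef0 coef_poly /c /= fact0 invr1 mul1r.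
  exact: subrr.
rewrite -[X in `|X|]/(phi t).
have -> : phi t = phi t - phi 0 by rewrite phi0 subr0.
apply: (@le_trans _ _ ((\sum_i K i) * `|h| ^+ N.+1 * `|t|)); last first.
  by rewrite ler_piMr // mulr_ge0 ?exprn_ge0 ?sumr_ge0.
apply: mean_value_bound phi' _ => s st.
rewrite (le_trans (ler_norm_sum _ _ _)) // mulr_suml; apply: ler_sum => i _.
rewrite normrM exprS mulrCA ler_pM ?norm_coord // -pE; apply: hi.
exact: le_trans st t1.
Qed.
End SmoothCalculus.

(** * Comparison up to powers of [delta] *)

Section Asymptotics.
Variable R : realType.
Implicit Types (f g : R -> R) (N : nat).

Lemma eq_uptoP (V : normedModType R) N (f g : R -> V) :
  eq_upto N f g <->
  exists K : R, \forall d \near 0^'+, `|f d - g d| <= K * `|d ^+ N|.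
Proof.
rewrite /eq_upto; split=> [/eqO_exP[K _ hK]|[K hK]]; first by exists K.
apply/eqO_exP; exists (Num.max 1 K) => /=; first by rewrite lt_max ltr01.
apply: filterS hK => d /= hd; apply: le_trans hd _.
by rewrite ler_wpM2r // le_max lexx orbT.
Qed.

Lemma eq_upto_refl (V : normedModType R) N (f : R -> V) : eq_upto N f f.
Proof.
by apply/eq_uptoP; exists 0; apply: nearW => d; rewrite subrr normr0 mul0r.
Qed.

Lemma eq_upto_sym (V : normedModType R) N (f g : R -> V) :
  eq_upto N f g -> eq_upto N g f.
Proof.
move=> /eq_uptoP[K hK]; apply/eq_uptoP; exists K.
by apply: filterS hK => d; rewrite distrC.
Qed.

Lemma eq_upto_trans (V : normedModType R) N (f g h : R -> V) :
  eq_upto N f g -> eq_upto N g h -> eq_upto N f h.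
Proof.
move=> /eq_uptoP[K hK] /eq_uptoP[L hL]; apply/eq_uptoP; exists (K + L).
apply: filterS2 hK hL => d h1 h2; rewrite mulrDl.
by rewrite -[f d](subrK (g d)) -addrA (le_trans (ler_normD _ _)) // lerD.
Qed.

Lemma eq_uptoD N f f' g g' : eq_upto N f f' -> eq_upto N g g' ->
  eq_upto N (fun d => f d + g d) (fun d => f' d + g' d).
Proof.
move=> /eq_uptoP[K hK] /eq_uptoP[L hL]; apply/eq_uptoP; exists (K + L).
apply: filterS2 hK hL => d h1 h2; rewrite mulrDl opprD addrACA.
by rewrite (le_trans (ler_normD _ _)) // lerD.
Qed.

Lemma eq_uptoN N f f' : eq_upto N f f' ->
  eq_upto N (fun d => - f d) (fun d => - f' d).
Proof.
move=> /eq_uptoP[K hK]; apply/eq_uptoP; exists K.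
by apply: filterS hK => d; rewrite -opprD normrN.
Qed.

Lemma eq_uptoW N N' f g : (N <= N')%N -> eq_upto N' f g -> eq_upto N f g.
Proof.
move=> hN /eq_uptoP[K hK]; apply/eq_uptoP; exists `|K|.
near=> d.
have d0 : 0 < d by near: d; exact: nbhs_right_gt.
have d1 : d <= 1 by near: d; apply: nbhs_right_le; exact: ltr01.
apply: (@le_trans _ _ (K * `|d ^+ N'|)); first by near: d.
rewrite (le_trans (ler_norm _)) // normrM normr_id ler_wpM2l //.
by rewrite !ger0_norm ?exprn_ge0 ?(ltW d0) // ler_wiXn2l // ltW.
Unshelve. all: by end_near. Qed.

Definition bounded_near0 (V : normedModType R) (f : R -> V) :=
  exists K : R, \forall d \near 0^'+, `|f d| <= K.

Lemma eq_uptoM N f f' g : bounded_near0 g -> eq_upto N f f' ->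
  eq_upto N (fun d => f d * g d) (fun d => f' d * g d).
Proof.
move=> [L hL] /eq_uptoP[K hK]; apply/eq_uptoP; exists (K * L).
apply: filterS2 hL hK => d h1 h2; rewrite -mulrBl normrM mulrAC.
by rewrite ler_pM.
Qed.

Lemma eq_upto_row m N (f g : R -> 'rV[R]_m) :
  eq_upto N f g <-> forall i, eq_upto N (fun d => f d 0 i) (fun d => g d 0 i).
Proof.
split=> [/eq_uptoP[K hK] i|h].
  apply/eq_uptoP; exists K; apply: filterS hK => d; apply: le_trans.
  by have := norm_coord (f d - g d) i; rewrite !mxE.
have /fin_all_exists[K hK] (i : 'I_m) := (eq_uptoP _ _ _).1 (h i).
apply/eq_uptoP; exists (\sum_i `|K i|).
have : \forall d \near (0 : R)^'+, forall i,
    `|f d 0 i - g d 0 i| <= K i * `|d ^+ N|.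
  exact: (@filter_forall _ _ (fun i d =>
    `|f d 0 i - g d 0 i| <= K i * `|d ^+ N|) _ _ hK).
apply: filterS => d hd.
apply: norm_row_le => [|i]; first by rewrite mulr_ge0 // sumr_ge0.
rewrite !mxE (le_trans (hd i)) // ler_wpM2r // (bigD1 i) //=.
by rewrite (le_trans (ler_norm _)) // lerDl sumr_ge0.
Qed.

Lemma cvg_horner_right (p : {poly R}) : p.[d] @[d --> 0^'+] --> p.[0].
Proof. by apply: cvg_at_right_filter; apply: continuous_horner. Qed.

Lemma bounded_near0_horner (p : {poly R}) : bounded_near0 (fun d => p.[d]).
Proof.
exists (`|p.[0]| + 1).
have : \forall d \near (0 : R)^'+, `|p.[0] - p.[d]| <= 1.
  by move/cvgrPdist_le: (@cvg_horner_right p); apply.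
apply: filterS => d hd; rewrite -[p.[d]](subrK p.[0]) addrC.
by rewrite (le_trans (ler_normD _ _)) // lerD2l distrC.
Qed.

(** The constant coefficient is the limit at 0, hence vanishes; dividing by delta then lowers N by
    one. *)
Lemma eq_upto_horner0 N (p : {poly R}) :
  eq_upto N (fun d => p.[d]) (fun=> 0) <-> forall j, (j < N)%N -> p`_j = 0.
Proof.
split=> [|h].
  elim: N p => [//|N IH] p /eq_uptoP[K hK].
  have p0 : p`_0 = 0.
    apply/eqP; rewrite -horner_coef0 -normr_le0.
    have X0 : (K *: 'X^(N.+1)).[0] = 0 by rewrite hornerZ hornerXn expr0n mulr0.
    rewrite -[leRHS]X0.
    apply: (ler_cvg_to (cvg_norm (@cvg_horner_right p))
      (@cvg_horner_right (K *: 'X^(N.+1)))).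
    apply: filterS2 hK (nbhs_right_gt 0) => d; rewrite subr0 hornerZ hornerXn.
    by move=> h d0; rewrite (ger0_norm (exprn_ge0 _ (ltW d0))) in h.
  have pE : p = drop_poly 1 p * 'X.
    rewrite -[LHS](poly_take_drop 1) expr1 -[RHS]add0r; congr (_ + _).
    by apply/polyP => -[|i]; rewrite coef_take_poly coef0.
  have hq : eq_upto N (fun d => (drop_poly 1 p).[d]) (fun=> 0).
    apply/eq_uptoP; exists K; apply: filterS2 hK (nbhs_right_gt 0) => d.
    rewrite {1}pE !subr0 hornerM hornerX exprSr !normrM mulrA => h d0.
    by rewrite ler_pM2r ?normr_gt0 ?gt_eqF in h.
  move=> [//|j]; rewrite ltnS => hj; have := IH _ hq j hj.
  by rewrite coef_drop_poly addn1.
have -> : p = drop_poly N p * 'X^N.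
  rewrite -[LHS](poly_take_drop N) -[RHS]add0r; congr (_ + _).
  by apply/polyP => j; rewrite coef_take_poly coef0; case: ltnP => // /h.
have [K hK] := bounded_near0_horner (drop_poly N p).
apply/eq_uptoP; exists K; apply: filterS hK => d hd.
by rewrite subr0 hornerM hornerXn normrM ler_wpM2r.
Qed.

(* Polynomials in delta (outer variable) and s (inner variable). *)
Definition ev2 (s d : R) (P : {poly {poly R}}) : R := P.[d%:P].[s].

Lemma ev2E s d P : ev2 s d P = (map_poly (horner_eval s) P).[d].
Proof. by rewrite -{2}[d](hornerC d s) -[d%:P.[s]]/(horner_eval s _) horner_map. Qed.

Lemma bounded_near0_ev2 s P : bounded_near0 (fun d => ev2 s d P).
Proof.
have [K hK] := bounded_near0_horner (map_poly (horner_eval s) P).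
by exists K; apply: filterS hK => d; rewrite ev2E.
Qed.

Lemma eq_upto_ev2 N s P Q :
  eq_upto N (fun d => ev2 s d P) (fun d => ev2 s d Q) <->
  forall j, (j < N)%N -> (P`_j).[s] = (Q`_j).[s].
Proof.
have h0 : eq_upto N (fun d => ev2 s d P) (fun d => ev2 s d Q) <->
    eq_upto N (fun d => (map_poly (horner_eval s) (P - Q)).[d]) (fun=> 0).
  split=> /eq_uptoP[K hK]; apply/eq_uptoP; exists K; apply: filterS hK => d;
  by rewrite -ev2E /ev2 subr0 hornerD hornerN hornerD hornerN.
split=> [/h0.1 h1 j hj | h].
  have := (eq_upto_horner0 _ _).1 h1 j hj; rewrite coef_map coefB /= /horner_eval hornerD hornerN.
  exact: subr0_eq.
apply/h0; apply/eq_upto_horner0 => j /h hj.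
by rewrite coef_map coefB /= /horner_eval hornerD hornerN hj subrr.
Qed.

(** The natural numbers embed in the field, so a nonzero difference would have more roots than its
    degree allows. *)
Lemma poly_eq_horner (p q : {poly R}) : (forall s, p.[s] = q.[s]) -> p = q.
Proof.
move=> h; apply/eqP; rewrite -subr_eq0; apply/negPn/negP => nz.
pose rs := [seq i%:R : R | i <- iota 0 (size (p - q))].
have : (size rs < size (p - q)%R)%N.
  apply: max_poly_roots nz _ _.
    by apply/allP => x /mapP[i _ ->]; rewrite rootE hornerD hornerN h subrr.
  by rewrite map_inj_uniq ?iota_uniq // => i j /eqP; rewrite eqr_nat => /eqP.
by rewrite size_map size_iota ltnn.
Qed.


End Asymptotics.

(** * Smooth functions of polynomials in delta *)

Section CompositionAsymptotics.
Variables (R : realType) (m : nat) (x0 : 'rV[R]_m).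
Implicit Types (f : 'rV[R]_m -> R) (X : 'I_m -> {poly {poly R}}).
Notation ev := (fun f : 'rV[R]_m -> R => f x0).

Lemma ev2_taylor N X f s d :
  ev2 s d (taylor_poly ev (@pd R m) (@cst2 R) N X f) =
  taylor_poly ev (@pd R m) id N (fun i => ev2 s d (X i)) f.
Proof.
pose phi : {rmorphism {poly {poly R}} -> R} := horner_eval s \o horner_eval d%:P.
have -> : id = phi \o @cst2 R.
  by apply/funext => c; rewrite /= /horner_eval /cst2 !hornerC.
exact: (taylor_poly_morph _ _ _ phi).
Qed.

(** Zero constant coefficients make the argument O(delta), so a remainder bounded by its N-th power
    is O(delta^N). *)
Lemma eq_upto_taylor N f X s : smooth f -> (forall i, (X i)`_0 = 0) ->
  eq_upto N (fun d => f (x0 + \row_i ev2 s d (X i)))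
    (fun d => ev2 s d (taylor_poly ev (@pd R m) (@cst2 R) N X f)).
Proof.
move=> hf hX; have [K K0 hK] := taylor_line x0 N hf.
pose h d : 'rV[R]_m := \row_i ev2 s d (X i).
have : eq_upto 1 h (fun=> 0).
  apply/eq_upto_row => i.
  have : eq_upto 1 (fun d => ev2 s d (X i)) (fun d => ev2 s d 0).
    by apply/eq_upto_ev2 => -[|//] _; rewrite hX coef0.
  move=> /eq_uptoP[C hC]; apply/eq_uptoP; exists C; apply: filterS hC => d.
  by rewrite !mxE /ev2 !horner0.
move=> /eq_uptoP[C hC]; move/nbhs_normP: hK => [/= r r0 hK].
apply/eq_uptoP; exists (K * (`|C| + 1) ^+ N).
near=> d.
have hd : `|h d| <= (`|C| + 1) * `|d|.
  have : `|h d - 0| <= C * `|d ^+ 1| by near: d.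
  rewrite subr0 expr1 => /le_trans; apply; rewrite ler_wpM2r //.
  by rewrite (le_trans (ler_norm _)) // lerDl.
have C1 : 0 < `|C| + 1 by rewrite ltr_wpDl.
have hr : `|h d| < r.
  apply: le_lt_trans hd _; rewrite -ltr_pdivlMl //.
  have d0 : 0 < d by near: d; exact: nbhs_right_gt.
  rewrite gtr0_norm //; near: d; apply: nbhs_right_lt.
  by rewrite mulr_gt0 // invr_gt0.
have := hK (h d); rewrite /= sub0r normrN => /(_ hr 1).
rewrite normr1 => /(_ (lexx _)); rewrite scale1r ev2_taylor.
under eq_bigr do rewrite expr1n mulr1.
have -> : \sum_(i < N) (i`!%:R)^-1 * taylor_term ev (@pd R m) id (h d 0) i f =
    taylor_poly ev (@pd R m) id N (fun i => ev2 s d (X i)) f.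
  by apply: eq_bigr => j _; congr (_ * _); apply: eq_taylor_term => i; rewrite mxE.
move/le_trans; apply; rewrite -mulrA ler_wpM2l // normrX -exprMn.
by rewrite lerXn2r // nnegrE // mulr_ge0 // ltW.
Unshelve. all: by end_near. Qed.

End CompositionAsymptotics.

(** * The contact system *)

(** Column j is the gradient of the j-th component, which is the form the order-n systems use for
    their matrix. *)
Lemma jacobian_pd (R : realType) (m n : nat) (Phi : 'rV[R]_m -> 'rV[R]_n) x :
  smooth_map Phi -> 'J Phi x = \matrix_(i, j) pd i (fun y => Phi y 0 j) x.
Proof.
move=> hPhi; have hd : differentiable Phi x.
  have -> : Phi = \sum_j (fun y => Phi y 0 j *: (delta_mx 0 j : 'rV[R]_n)).
    by apply/funext => y; rewrite fct_sumE {1}(row_sum_delta (Phi y)).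
  apply: differentiable_sum => j; apply: differentiableZl.
  exact: smooth_differentiable.
apply/matrixP => i j; rewrite !mxE -deriveE // derive_mx; last exact: diff_derivable.
by rewrite mxE.
Qed.

Section SystemSmoothness.
Variables (R : realType) (k : nat) (S : contact_system R (4 + k)).
Variables (J : 'rV[R]_(4 + k) -> 'rV[R]_k).
Hypotheses (HS : contact_assumptions S) (HJ : smooth_map J).

Lemma smooth_calV : smooth (calV S).
Proof. exact: smooth_lieD (smooth_cF HS) (smooth_cY HS). Qed.

Lemma smooth_calB : smooth (calB S).
Proof. exact: smooth_lieD (smooth_cF HS) smooth_calV. Qed.

Lemma smooth_cG : smooth_map (cG S).
Proof.
move=> j; have -> : (fun x => cG S x 0 j) =
    fun x => cGN S x 0 j + (- cmu S) * cGT S x 0 j.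
  by apply/funext => x; rewrite !mxE mulNr.
apply: smoothD; first exact: (smooth_cGN HS).
by apply: smoothM; [exact: smooth_cst | exact: (smooth_cGT HS)].
Qed.

Lemma smooth_calP : smooth (calP S).
Proof. exact: smooth_lieD smooth_cG smooth_calV. Qed.

Lemma smooth_alpha1 : smooth (alpha1 S).
Proof. exact: smooth_lieD (smooth_cF HS) smooth_calP. Qed.

Lemma smooth_alpha2 : smooth (alpha2 S).
Proof. exact: smooth_lieD (smooth_cF HS) smooth_calB. Qed.

Lemma smooth_alpha3 : smooth (alpha3 S).
Proof.
have -> : alpha3 S = fun x => (-1) * lieD (cG S) (calB S) x.
  by apply/funext => x; rewrite mulN1r.
apply: smoothM; first exact: smooth_cst.
exact: smooth_lieD smooth_cG smooth_calB.
Qed.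

Lemma smooth_constraint_map : smooth_map (constraint_map S J).
Proof.
move=> j; rewrite /constraint_map; case: (splitP j) => i ji.
  have -> : j = lshift k i by apply: val_inj.
  have -> : (fun x => row_mx
      (\row_(i < 4) [:: calP S x; calB S x; cY S x; calV S x]`_i)
      (J x) 0 (lshift k i)) =
      fun x => [:: calP S x; calB S x; cY S x; calV S x]`_i.
    by apply/funext => x; rewrite row_mxEl mxE.
  case: i {ji} => -[|[|[|[|//]]]] /= _.
  - exact: smooth_calP.
  - exact: smooth_calB.
  - exact: (smooth_cY HS).
  - exact: smooth_calV.
have -> : j = rshift 4 i by apply: val_inj.
have -> : (fun x => row_mx
    (\row_(i < 4) [:: calP S x; calB S x; cY S x; calV S x]`_i)
    (J x) 0 (rshift 4 i)) = fun x => J x 0 i.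
  by apply/funext => x; rewrite row_mxEr.
exact: HJ.
Qed.

End SystemSmoothness.

(** * Truncated series as values of polynomials in delta and s *)

Section SeriesEvaluation.
Variables (R : realType) (k M : nat).
Notation m := (4 + k)%N.
Variable xis : 'rV[R]_m.

Definition seq_coefs (u : nat -> state R m) : coefs R m M :=
  @Coefs R m M [ffun n : 'I_M => sxi (u n)] [ffun n : 'I_M => sp (u n)]
    [ffun n : 'I_M => sb (u n)] [ffun n : 'I_M => sy (u n)]
    [ffun n : 'I_M => sv (u n)] [ffun n : 'I_M => sz (u n)]
    [ffun n : 'I_M => sl (u n)].

(** Extends by zero states beyond M, so that any candidate solution can be handled as a sequence
    over all naturals. *)
Lemma coefs_seq (c : coefs R m M) : exists u, c = seq_coefs u.
Proof.
exists (fun n => if insub n is Some i then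
  State (xi_ c i) (p_ c i) (b_ c i) (y_ c i) (v_ c i) (z_ c i) (lam_ c i)
  else State 0 0 0 0 0 0 0).
case: c => ? ? ? ? ? ? ?; rewrite /seq_coefs /=.
by congr Coefs; apply/ffunP => i; rewrite ffunE valK.
Qed.

Lemma eq_seq_coefs u u' : (forall n, (n < M)%N -> u n = u' n) ->
  seq_coefs u = seq_coefs u'.
Proof. by move=> h; congr Coefs; apply/ffunP => i; rewrite !ffunE h. Qed.

Implicit Types (u : nat -> state R m) (g : state R m -> {poly R}).

Lemma ev2_gen g u s d : ev2 s d (gen g u M) = \sum_(n < M) (g (u n)).[s] * d ^+ n.
Proof.
rewrite /ev2 /gen horner_poly horner_sum; apply: eq_bigr => i _.
by rewrite hornerM -polyC_exp hornerC.
Qed.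

Lemma series_atE g u s d :
  series_at [ffun n : 'I_M => g (u n)] s d = ev2 s d (gen g u M).
Proof. by rewrite ev2_gen; apply: eq_bigr => i _; rewrite ffunE. Qed.

Lemma derive1_series g u s d :
  derive1 (fun t => series_at [ffun n : 'I_M => g (u n)] t d) s =
  ev2 s d (gen (fun st => (g st)^`()) u M).
Proof.
have -> : (fun t => series_at [ffun n : 'I_M => g (u n)] t d) =
    horner (\sum_(n < M) d ^+ n *: g (u n)).
  apply/funext => t; rewrite horner_sum; apply: eq_bigr => i _.
  by rewrite ffunE hornerZ mulrC.
rewrite -derivE ev2_gen raddf_sum horner_sum; apply: eq_bigr => i _.
by rewrite /= derivZ hornerZ mulrC.
Qed.

Lemma row_series_atE u s d i :
  row_series_at [ffun n : 'I_M => sxi (u n)] s d 0 i =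
  ev2 s d (gen (fun st => sxi st 0 i) u M).
Proof.
rewrite ev2_gen summxE; apply: eq_bigr => j _.
by rewrite ffunE !mxE mulrC.
Qed.

Lemma xi_at u s d : xis + d ^+ 2 *: row_series_at [ffun n : 'I_M => sxi (u n)] s d =
  xis + \row_i ev2 s d (Xi u M i).
Proof.
congr (_ + _); apply/rowP => i; rewrite !mxE row_series_atE /ev2 /Xi.
by rewrite hornerM hornerXn -polyC_exp hornerM hornerC.
Qed.

Lemma derive1_row_series u s d i :
  derive1 (fun t => row_series_at [ffun n : 'I_M => sxi (u n)] t d) s 0 i =
  ev2 s d (gen (fun st => (sxi st 0 i)^`()) u M).
Proof.
have hi j : (fun t => row_series_at [ffun n : 'I_M => sxi (u n)] t d 0 j) =
    fun t => series_at [ffun n : 'I_M => sxi (u n) 0 j] t d.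
  by apply/funext => t; rewrite row_series_atE (series_atE (fun st => sxi st 0 j)).
rewrite derive1E derive_mx; last first.
  apply/derivable_mxP => i' j; rewrite (ord1 i') hi.
  have -> : (fun t => series_at [ffun n : 'I_M => sxi (u n) 0 j] t d) =
      horner (\sum_(n < M) d ^+ n *: sxi (u n) 0 j).
    apply/funext => t; rewrite horner_sum; apply: eq_bigr => l _.
    by rewrite ffunE hornerZ mulrC.
  exact: derivable_horner.
by rewrite mxE hi -derive1E (derive1_series (fun st => sxi st 0 i)).
Qed.

End SeriesEvaluation.

(** * The asymptotic equations as coefficient identities *)

Section FormalEquations.
Variables (R : realType) (k M : nat).
Notation m := (4 + k)%N.
Variables (S : contact_system R m) (J : 'rV[R]_m -> 'rV[R]_k) (xis : 'rV[R]_m).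
Hypotheses (HS : contact_assumptions S) (HJ : smooth_map J).
Hypothesis HPhi0 : constraint_map S J xis = 0.

Notation ev := (fun f : 'rV[R]_m -> R => f xis).
Notation F := (fun i x => cF S x 0 i).
Notation G := (fun i x => cG S x 0 i).
Notation Phi := (fun j x => constraint_map S J x 0 j).
Variable u : nat -> state R m.
Notation jj := (taylor_poly ev (@pd R m) (@cst2 R) M.+2 (Xi u M)).
Notation gen g := (gen g u M).
Notation xit s d := (row_series_at [ffun n : 'I_M => sxi (u n)] s d).
Notation at_xi f s d := (f (xis + d ^+ 2 *: xit s d)).

Lemma coef_gen g n : (n < M)%N -> (gen g)`_n = g (u n).
Proof. by move=> h; rewrite coef_poly h. Qed.

Lemma eq_upto_at f s : smooth f ->
  eq_upto M.+2 (fun d => at_xi f s d) (fun d => ev2 s d (jj f)).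
Proof.
move=> hf; have -> : (fun d => at_xi f s d) =
    fun d => f (xis + \row_i ev2 s d (Xi u M i)).
  by apply/funext => d; rewrite xi_at.
by apply: eq_upto_taylor => // i; apply: Xi0.
Qed.

Lemma eq_uptoMat f g s : smooth f ->
  eq_upto M (fun d => at_xi f s d * series_at [ffun n : 'I_M => g (u n)] s d)
    (fun d => ev2 s d (jj f * gen g)).
Proof.
move=> hf; have -> : (fun d => ev2 s d (jj f * gen g)) =
    fun d => ev2 s d (jj f) * series_at [ffun n : 'I_M => g (u n)] s d.
  by apply/funext => d; rewrite (series_atE M g u) /ev2 !hornerM.
apply: eq_uptoM.
  have [K hK] := bounded_near0_ev2 s (gen g); exists K; apply: filterS hK => d.
  by rewrite (series_atE M g u).
by apply: eq_uptoW (eq_upto_at s hf); rewrite ltnW.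
Qed.

(** For each s the coefficients of delta^n agree at s; agreement at all s makes them equal as
    polynomials. *)
Lemma eq_upto_coefs (f g : R -> R -> R) P Q :
  (forall s d, f s d = ev2 s d P) ->
  (forall s, eq_upto M (g s) (fun d => ev2 s d Q)) ->
  (forall s, eq_upto M (f s) (g s)) <-> forall n, (n < M)%N -> P`_n = Q`_n.
Proof.
move=> hf hg; have {}hf s : f s = fun d => ev2 s d P by apply/funext => d.
split=> [h n hn|h s]; last first.
  apply: eq_upto_trans (eq_upto_sym (hg s)); rewrite hf.
  by apply/eq_upto_ev2 => j /h ->.
apply: poly_eq_horner => s.
have := eq_upto_trans (h s) (hg s); rewrite hf.
by move=> /eq_upto_ev2; apply.
Qed.

(** Orders 0 and 1 hold by themselves: f vanishes at the base point, the argument starts at delta^2,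
    and e > 1. Orders 2 to M + 1 remain, one for each n < M. *)
Lemma cond_coefs f g e : smooth f -> f xis = 0 -> (1 < e)%N ->
  eq_upto (M + 2) (fun d => at_xi f 0 d
      - d ^+ e * series_at [ffun n : 'I_M => g (u n)] 0 d) (fun=> 0) <->
  forall n, (n < M)%N -> ((jj f)`_n.+2).[0] = (('X^e * gen g)`_n.+2).[0].
Proof.
move=> hf f0 he; rewrite addn2.
have ha : eq_upto M.+2 (fun d => at_xi f 0 d
      - d ^+ e * series_at [ffun n : 'I_M => g (u n)] 0 d)
    (fun d => ev2 0 d (jj f - 'X^e * gen g)).
  have -> : (fun d => ev2 0 d (jj f - 'X^e * gen g)) = fun d => ev2 0 d (jj f)
      - d ^+ e * series_at [ffun n : 'I_M => g (u n)] 0 d.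
    apply/funext => d; rewrite (series_atE M g u) /ev2 !(hornerD, hornerN, hornerM).
    by rewrite hornerXn -polyC_exp hornerC.
  by apply: eq_uptoD; [exact: eq_upto_at | exact: eq_upto_refl].
have h0 : (fun=> 0) = fun d => ev2 0 d (0 : {poly {poly R}}).
  by apply/funext => d; rewrite /ev2 !horner0.
split=> [h n hn|h].
  have := eq_upto_trans (eq_upto_sym ha) h; rewrite h0.
  move=> /eq_upto_ev2/(_ n.+2 hn); rewrite coefB coef0 horner0 hornerD hornerN.
  exact: subr0_eq.
apply: eq_upto_trans ha _; rewrite h0; apply/eq_upto_ev2 => -[|[|j]] hj.
- by rewrite coefB taylor_poly_coef0 ?f0 ?coefXnM ?(ltnW he) ?subr0 ?coef0 // => i; apply: Xi0.
- by rewrite coefB taylor_Xi_coef1 coefXnM he subr0 coef0.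
- by rewrite coefB coef0 horner0 hornerD hornerN (h j hj) subrr.
Qed.


(** Passing the index to [Q] along with the function lets each component be matched with its own
    entry of [rhs]. *)
Lemma Phi_forall (Q : ('rV[R]_m -> R) -> nat -> Prop) :
  (forall j : 'I_m, Q (Phi j) j) <->
  [/\ Q (calP S) 0%N, Q (calB S) 1%N, Q (cY S) 2%N, Q (calV S) 3%N &
     forall i : 'I_k, Q (fun x => J x 0 i) (4 + i)%N].
Proof.
have hl (i : 'I_4) : Phi (lshift k i) =
    fun x => [:: calP S x; calB S x; cY S x; calV S x]`_i.
  by apply/funext => x; rewrite row_mxEl mxE.
have hr (i : 'I_k) : Phi (rshift 4 i) = fun x => J x 0 i.
  by apply/funext => x; rewrite row_mxEr.
split=> [H|[H0 H1 H2 H3 H4] j].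
  split; last by move=> i; have := H (rshift 4 i); rewrite hr.
  - by have := H (lshift k (Ordinal (isT : 0 < 4)%N)); rewrite hl.
  - by have := H (lshift k (Ordinal (isT : 1 < 4)%N)); rewrite hl.
  - by have := H (lshift k (Ordinal (isT : 2 < 4)%N)); rewrite hl.
  - by have := H (lshift k (Ordinal (isT : 3 < 4)%N)); rewrite hl.
case: (splitP j) => i ji; last first.
  have -> : j = rshift 4 i by apply: val_inj.
  by rewrite hr.
have -> : j = lshift k i by apply: val_inj.
by rewrite hl; case: i {ji} => -[|[|[|[|//]]]] /=.
Qed.

Lemma eq_upto_exact s (g : R -> R) Q : (forall d, g d = ev2 s d Q) ->
  eq_upto M g (fun d => ev2 s d Q).
Proof. by move=> h; rewrite (funext h); apply: eq_upto_refl. Qed.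

Lemma formal_solutionE :
  formal_solution S J xis (seq_coefs M u) <->
  forall n, (n < M)%N -> order_eqs ev (@pd R m) M F G Phi
    (alpha1 S) (alpha2 S) (alpha3 S) M n u.
Proof.
have hF i : smooth (fun x => F i x) by exact: (smooth_cF HS).
have hG i : smooth (fun x => G i x) by exact: (smooth_cG HS).
have at0 f s (hf : smooth f) : eq_upto M (fun d => at_xi f s d)
    (fun d => ev2 s d (jj f)).
  by apply: eq_uptoW (eq_upto_at s hf); rewrite ltnW.
have Exi : (forall s, eq_upto M
    (fun d => derive1 (fun t => xit t d) s)
    (fun d => at_xi (cF S) s d +
       series_at [ffun n : 'I_M => sl (u n)] s d *: at_xi (cG S) s d)) <->
    forall n, (n < M)%N -> forall i, (sxi (u n) 0 i)^`() =
      (jj (F i) + jj (G i) * gen (@sl R m))`_n.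
  have h i := @eq_upto_coefs (fun s d => derive1 (fun t => xit t d) s 0 i)
    (fun s d => at_xi (F i) s d + at_xi (G i) s d *
       series_at [ffun n : 'I_M => sl (u n)] s d)
    (gen (fun st => (sxi st 0 i)^`())) (jj (F i) + jj (G i) * gen (@sl R m))
    (fun s d => derive1_row_series M u s d i).
  have {}h i : (forall s, eq_upto M (fun d => derive1 (fun t => xit t d) s 0 i)
      (fun d => at_xi (F i) s d + at_xi (G i) s d *
       series_at [ffun n : 'I_M => sl (u n)] s d)) <->
     forall n, (n < M)%N -> (sxi (u n) 0 i)^`() =
      (jj (F i) + jj (G i) * gen (@sl R m))`_n.
    have [|h1 h2] := h i.
      move=> s; have -> : (fun d => ev2 s d (jj (F i) + jj (G i) * gen (@sl R m))) =
         fun d => ev2 s d (jj (F i)) + ev2 s d (jj (G i) * gen (@sl R m)).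
        by apply/funext => d; rewrite /ev2 !hornerD.
      by apply: eq_uptoD; [exact: at0 | exact: eq_uptoMat].
    split=> [/h1 H n hn|H]; first by rewrite -H // coef_gen.
    by apply: h2 => n hn; rewrite coef_gen // H.
  have e s i : (fun d => (at_xi (cF S) s d +
      series_at [ffun n : 'I_M => sl (u n)] s d *: at_xi (cG S) s d) 0 i) =
      (fun d => at_xi (F i) s d + at_xi (G i) s d *
       series_at [ffun n : 'I_M => sl (u n)] s d).
    by apply/funext => d; rewrite [LHS]mxE; congr (_ + _); rewrite [LHS]mxE; apply: mulrC.
  split=> [H n hn i|H s].
    by apply: (h i).1 hn => s; rewrite -e; apply: ((eq_upto_row _ _ _).1 (H s) i).
  apply/eq_upto_row => i; rewrite e.
  exact: ((h i).2 (fun n hn => H n hn i) s).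
have Ep := eq_upto_coefs (derive1_series M (@sp R m) u)
  (fun s => at0 _ s (smooth_alpha1 HS)).
have Eb := eq_upto_coefs (derive1_series M (@sb R m) u)
  (g := fun s d => at_xi (alpha2 S) s d -
     at_xi (alpha3 S) s d * series_at [ffun n : 'I_M => sl (u n)] s d)
  (Q := jj (alpha2 S) - jj (alpha3 S) * gen (@sl R m)).
have Ey := eq_upto_coefs (derive1_series M (@sy R m) u)
  (fun s => eq_upto_exact (series_atE M (@sv R m) u s)).
have Ev := eq_upto_coefs (derive1_series M (@sv R m) u)
  (g := fun s d => series_at [ffun n : 'I_M => sb (u n)] s d +
     series_at [ffun n : 'I_M => sp (u n)] s d *
     series_at [ffun n : 'I_M => sl (u n)] s d)
  (Q := gen (@sb R m) + gen (@sp R m) * gen (@sl R m)).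
have Ez := @eq_upto_coefs
  (fun s d => d * derive1 (fun t => series_at [ffun n : 'I_M => sz (u n)] t d) s)
  (fun s d => - series_at [ffun n : 'I_M => sz (u n)] s d -
     series_at [ffun n : 'I_M => sl (u n)] s d)
  ('X * gen (fun st => (sz st)^`())) (- gen (@sz R m) - gen (@sl R m)).
have El := eq_upto_coefs (series_atE M (@sl R m) u)
  (g := fun s d => series_at [ffun n : 'I_M => sz (u n)] s d -
     series_at [ffun n : 'I_M => sy (u n)] s d)
  (Q := gen (@sz R m) - gen (@sy R m)).
have {Eb}[|Eb1 Eb2] := Eb.
  move=> s; have -> : (fun d => ev2 s d (jj (alpha2 S) - jj (alpha3 S) *
      gen (@sl R m))) = fun d => ev2 s d (jj (alpha2 S)) -
      ev2 s d (jj (alpha3 S) * gen (@sl R m)).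
    by apply/funext => d; rewrite /ev2 !(hornerD, hornerN).
  apply: eq_uptoD; first exact: at0 (smooth_alpha2 HS).
  exact: eq_uptoN (eq_uptoMat _ _ (smooth_alpha3 HS)).
have {Ev}[|Ev1 Ev2] := Ev.
  move=> s; apply: eq_upto_exact => d; rewrite (series_atE M (@sb R m) u).
  rewrite (series_atE M (@sp R m) u) (series_atE M (@sl R m) u) /ev2.
  by rewrite !(hornerD, hornerM).
have {Ez}[||Ez1 Ez2] := Ez.
- move=> s d; rewrite (derive1_series M (@sz R m) u) /ev2.
  by rewrite hornerM hornerX hornerM hornerC.
- move=> s; apply: eq_upto_exact => d; rewrite (series_atE M (@sz R m) u).
  by rewrite (series_atE M (@sl R m) u) /ev2 !(hornerD, hornerN).
have {El}[|El1 El2] := El.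
  move=> s; apply: eq_upto_exact => d; rewrite (series_atE M (@sz R m) u).
  by rewrite (series_atE M (@sy R m) u) /ev2 !(hornerD, hornerN).
have zX n : (n < M)%N ->
    ('X * gen (fun st => (sz st)^`()))`_n = zprev u n.
  case: n => [|n] hn; rewrite coefXM //= coef_gen //; exact: ltnW.
have Cp : eq_upto (M + 2) (fun d => series_at [ffun n : 'I_M => sp (u n)] 0 d)
    (fun=> 0) <-> forall n, (n < M)%N -> (sp (u n)).[0] = 0.
  have -> : (fun d => series_at [ffun n : 'I_M => sp (u n)] 0 d) =
      (fun d => ev2 0 d (gen (@sp R m))).
    by apply/funext => d; rewrite (series_atE M (@sp R m) u).
  have -> : (fun=> 0) = fun d => ev2 0 d (0 : {poly {poly R}}).
    by apply/funext => d; rewrite /ev2 !horner0.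
  split=> [/eq_upto_ev2 H n hn|H].
    by have := H n (ltn_addr _ hn); rewrite coef_gen // coef0 horner0.
  (* Orders M and M + 1 cost nothing, as the series for p stops before them. *)
  apply/eq_upto_ev2 => n _; rewrite coef_poly coef0 horner0.
  by case: ltnP => [/H //|_]; rewrite horner0.
have Phi0 : [/\ calP S xis = 0, calB S xis = 0, cY S xis = 0, calV S xis = 0 &
    forall i : 'I_k, J xis 0 i = 0].
  have [H _] := Phi_forall (fun f _ => f xis = 0).
  by apply: H => j; rewrite HPhi0 mxE.
have [P0 B0 Y0 V0 J0] := Phi0.
have CP := cond_coefs (@sp R m) (smooth_calP HS) P0 (isT : (1 < 2)%N).
have CB := cond_coefs (@sb R m) (smooth_calB HS) B0 (isT : (1 < 2)%N).
have CY := cond_coefs (@sy R m) (smooth_cY HS) Y0 (isT : (1 < 6)%N).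
have CV := cond_coefs (@sv R m) (smooth_calV HS) V0 (isT : (1 < 4)%N).
have CJ : eq_upto (M + 2) (fun d => at_xi J 0 d) (fun=> 0) <->
    forall n, (n < M)%N -> forall i, ((jj (fun x => J x 0 i))`_n.+2).[0] = 0.
  (* The condition on J has no scaled unknown, so it is treated with the zero series in that
     place. *)
  have g0 : gen (fun=> 0) = 0.
    by apply/polyP => j; rewrite coef_poly coef0 if_same.
  have h (i : 'I_k) := cond_coefs (fun=> 0) (HJ i) (J0 i) (isT : (1 < 2)%N).
  have e0 (i : 'I_k) : (fun d => at_xi (fun x => J x 0 i) 0 d -
      d ^+ 2 * series_at [ffun n : 'I_M => (fun=> 0) (u n)] 0 d) =
      fun d => at_xi J 0 d 0 i.
    apply/funext => d; rewrite (series_atE M (fun=> 0) u) g0.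
    by rewrite /ev2 !horner0 mulr0 subr0.
  split=> [H n hn i|H].
    have := (h i).1; rewrite e0 => {}h; rewrite h // ?g0 ?mulr0 ?coef0 ?horner0 //.
    have := (eq_upto_row _ _ _).1 H i; congr eq_upto.
    by apply/funext => d; rewrite mxE.
  apply/eq_upto_row => i; have := (h i).2; rewrite e0 => {}h.
  have -> : (fun d : R => (0 : 'rV[R]_k) 0 i) = fun=> 0.
    by apply/funext => d; rewrite mxE.
  by apply: h => n hn; rewrite g0 mulr0 coef0 horner0 H.
have r2 g n : (n < M)%N -> ('X^2 * gen g)`_n.+2 = g (u n).
  by move=> hn; rewrite coefXnM /= subn2 coef_gen.
have rY n : (n < M)%N -> ('X^6 * gen (@sy R m))`_n.+2 = rhs u n 2.
  move=> hn; rewrite coefXnM /= !ltnS; case: (leqP n 3) => // _.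
  by rewrite !subSS coef_gen //; apply: leq_ltn_trans (leq_subr _ _) hn.
have rV n : (n < M)%N -> ('X^4 * gen (@sv R m))`_n.+2 = rhs u n 3.
  move=> hn; rewrite coefXnM /= !ltnS; case: (leqP n 1) => // _.
  by rewrite !subSS coef_gen //; apply: leq_ltn_trans (leq_subr _ _) hn.
split.
  move=> [[/Exi.1 e1 /Ep.1 e2 /Eb1 e3 /Ey.1 e4 /Ev1 e5 /Ez1 e6 /El1 e7]].
  move=> [/Cp.1 c1 /CP.1 c2 /CB.1 c3 /CY.1 c4 /CV.1 c5 /CJ.1 c6] n hn.
  split.
  - exact: e1.
  - by rewrite -e2 // coef_gen.
  - by rewrite -e3 // coef_gen.
  - by have := e4 n hn; rewrite !coef_gen.
  - by have := e5 n hn; rewrite coefD !coef_gen.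
  - by have := e6 n hn; rewrite coefB coefN zX // !coef_gen.
  - by have := e7 n hn; rewrite coefB !coef_gen.
  - exact: c1.
  - have [_ H] := Phi_forall (fun f j => ((jj f)`_n.+2).[0] = (rhs u n j).[0]).
    apply: H; split.
    + by rewrite c2 // r2.
    + by rewrite c3 // r2.
    + by rewrite c4 // rY.
    + by rewrite c5 // rV.
    + by move=> i; rewrite c6 // horner0.
move=> H.
have HQ n (hn : (n < M)%N) := (Phi_forall (fun f j =>
   ((jj f)`_n.+2).[0] = (rhs u n j).[0])).1 (oe_Phi (H n hn)).
split; split.
- by apply: Exi.2 => n /H[].
- by apply: Ep.2 => n hn; rewrite coef_gen //; case: (H n hn).
- by apply: Eb2 => n hn; rewrite coef_gen //; case: (H n hn).
- by apply: Ey.2 => n hn; rewrite !coef_gen //; case: (H n hn).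
- by apply: Ev2 => n hn; rewrite coefD !coef_gen //; case: (H n hn).
- by apply: Ez2 => n hn; rewrite coefB coefN zX // !coef_gen //; case: (H n hn).
- by apply: El2 => n hn; rewrite coefB !coef_gen //; case: (H n hn).
- by apply: Cp.2 => n /H[].
- by apply: CP.2 => n hn; rewrite r2 //; have [] := HQ n hn.
- by apply: CB.2 => n hn; rewrite r2 //; have [] := HQ n hn.
- by apply: CY.2 => n hn; rewrite rY //; have [] := HQ n hn.
- by apply: CV.2 => n hn; rewrite rV //; have [] := HQ n hn.
- by apply: CJ.2 => n hn i; have [_ _ _ _ ->] := HQ n hn; rewrite horner0.
Qed.

End FormalEquations.

Lemma in_P_of_inP (R : realType) (n : int) (f : {poly R}) : inP n f -> in_P n f.
Proof.
case: n => d hf; last first.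
  apply/polyP => i; rewrite coef0; apply/eqP; apply: contraT => /hf[t].
  by [].
exists (fun j => f`_(d - 3 * j)); apply/polyP => i; rewrite coef_sum.
have [fi|/hf[t /eqP]] := eqVneq f`_i 0.
  rewrite fi big1 // => j _; rewrite coefZ coefXn.
  by case: eqVneq => [<-|_]; rewrite ?fi ?mul0r ?mulr0.
rewrite eqz_nat => /eqP dE.
have ht : (t < (d %/ 3).+1)%N by lia.
rewrite (bigD1 (Ordinal ht)) //= big1 => [|j hj]; last first.
  rewrite coefZ coefXn; case: eqVneq => [e|_]; last by rewrite mulr0.
  have := ltn_ord j; move: hj; rewrite -val_eqE /= => hj hj2; lia.
have -> : (d - 3 * t = i)%N by lia.
by rewrite coefZ coefXn eqxx mulr1 addr0.
Qed.

Lemma seq_coefs_pattern (R : realType) (k M : nat) (u : nat -> state R (4 + k)) :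
  (forall n, (n < M)%N -> order_pattern n (u n)) ->
  even_pattern (seq_coefs M u) /\ odd_pattern (seq_coefs M u).
Proof.
move=> hu; split=> n nu hn; have [hxi hp hb hy hv hz hl] := hu n (ltn_ord n).
  have e1 : weight n = nu by rewrite hn /weight mul2n odd_double doubleK.
  have e2 : weight_y n = nu by rewrite /weight_y e1 hn oddM addr0.
  rewrite e1 e2 in hxi hp hb hy hv hz hl.
  by split; [split|move=> i|split| |]; apply: in_P_of_inP; rewrite /= ffunE.
have e1 : weight n = nu%:Z - 4.
  by rewrite hn /weight addn1 mul2n /= odd_double uphalf_double.
have e2 : weight_y n = nu%:Z - 1 by rewrite /weight_y e1 hn addn1 /= oddM /=; lia.
have e3 : weight n + 1 = nu%:Z - 3 by rewrite e1; lia.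
have e4 : weight_y n - 1 = nu%:Z - 2 by rewrite e2; lia.
rewrite e3 in hxi hp hb; rewrite e4 in hv; rewrite e1 in hl; rewrite e2 in hy hz.
by split; [split|move=> i|split| |]; apply: in_P_of_inP; rewrite /= ffunE.
Qed.

Unset Implicit Arguments.

Theorem theorem1 (R : realType) (k : nat)
    (S : contact_system R (4 + k)) (J : 'rV[R]_(4 + k) -> 'rV[R]_k)
    (xis : 'rV[R]_(4 + k))
    (HS : contact_assumptions S) (HJ : smooth_map J)
    (HY0 : cY S xis = 0) (HV0 : calV S xis = 0)
    (HP0 : calP S xis = 0) (HB0 : calB S xis = 0) (HJ0 : J xis = 0)
    (Hjac : 'J (constraint_map S J) xis \in unitmx)
    (Ha1 : alpha1 S xis < 0) (Ha3 : alpha3 S xis < 0)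
    (Hbeta : alpha3 S xis / alpha1 S xis \isn't a Num.int)
    (M : nat) (HM : (1 <= M)%N) :
  exists c : coefs R (4 + k) M,
    [/\ formal_solution S J xis c,
        forall c' : coefs R (4 + k) M, formal_solution S J xis c' -> c' = c,
        even_pattern c
      & odd_pattern c].
Proof.
have HPhi0 : constraint_map S J xis = 0.
  apply/rowP => j; rewrite [RHS]mxE.
  have [_ H] := @Phi_forall _ _ S J (fun f _ => f xis = 0).
  by apply: (H _ j); split=> // i; rewrite HJ0 mxE.
(* An equality would give beta = d + 1, an integer. *)
have ha d : alpha1 S xis * d.+1%:R != alpha3 S xis.
  apply: contraNneq Hbeta => <-; rewrite mulrAC divff ?lt_eqF // mul1r.
  exact: natr_int.
rewrite jacobian_pd in Hjac; last exact: smooth_constraint_map.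
pose lin := lin_eqs (fun f : 'rV[R]_(4 + k) -> R => f xis) (@pd R (4 + k)) M
  (fun i x => cF S x 0 i) (fun i x => cG S x 0 i)
  (fun j x => constraint_map S J x 0 j) (alpha1 S) (alpha2 S) (alpha3 S).
have solE u : formal_solution S J xis (seq_coefs M u) <->
    forall n, (n < M)%N -> lin n u.
  split=> [/formal_solutionE H n hn|H].
    by apply/(order_eqsE _ _ _ _ _ _ _ _ _ _ hn); apply: H.
  apply/formal_solutionE => // n hn.
  by apply/order_eqsE => //; apply: H.
have [u hu] : exists u, forall n, (n < M)%N -> lin n u /\ order_pattern n (u n).
  exact: (solution_exists _ _ _ _ ha).
have linU u1 u2 : (forall n, (n < M)%N -> lin n u1) ->
    (forall n, (n < M)%N -> lin n u2) -> forall n, (n < M)%N -> u1 n = u2 n.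
  exact: (solution_unique ha).
exists (seq_coefs M u).
have [he ho] : even_pattern (seq_coefs M u) /\ odd_pattern (seq_coefs M u).
  by apply: seq_coefs_pattern => n /hu[].
split=> // [|c']; first by apply/solE => n /hu[].
have [u' ->] := coefs_seq c' => /solE hu'.
apply: eq_seq_coefs => n hn.
by apply: linU hu' _ n hn => j /hu[].
Qed.
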